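(* For every $\delta\in(0,\pi)$ there exists a non-circular magnetic billiard in the plane with the $\delta$-Gutkin property, i.e. a bounded domain $\Omega\subset\mathbb{R}^2$ whose boundary is a smooth simple closed curve that is not a circle, together with a magnitude $\beta>0$ of the magnetic field, such that the magnetic billiard in $\Omega$ has the $\delta$-Gutkin property.
   Context: Magnetic billiard in $\Omega$ with constant field of magnitude $\beta>0$: a particle moves inside $\Omega$ with unit speed along arcs of circles of radius $r=1/\beta$ traversed counterclockwise (Larmor arcs); on hitting $\gamma=\partial\Omega$ it is reflected by the law of geometric optics. The billiard has the $\delta$-Gutkin property ($0<\delta<\pi$) if every Larmor arc entering $\Omega$ making angle $\delta$ with $\gamma$ exits $\Omega$ making the same angle $\delta$ with $\gamma$. *)

(* Defs.v *)
From mathcomp Require Import all_boot all_order all_algebra.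
From mathcomp Require Import all_classical all_reals all_analysis.
From mathcomp Require Import Rstruct Rstruct_topology.
Import Order.TTheory GRing.Theory Num.Theory.
Import numFieldNormedType.Exports.
Set Implicit Arguments. Unset Strict Implicit. Unset Printing Implicit Defensive.
Local Open Scope ring_scope.
Local Open Scope classical_set_scope.

Section Plane.
Variable R : realType.
Notation P := (R * R)%type.

Definition padd (p q : P) : P := (p.1 + q.1, p.2 + q.2).
Definition pscale (a : R) (p : P) : P := (a * p.1, a * p.2).
Definition dot (p q : P) : R := p.1 * q.1 + p.2 * q.2.
Definition pnorm (p : P) : R := Num.sqrt (dot p p).
Definition rot90 (p : P) : P := (- p.2, p.1).

Definition smooth_fun (f : R -> R) : Prop :=
  forall (n : nat) (x : R), derivable (derive1n n f) x 1.

Definition vel (g : R -> P) (t : R) : P :=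
  ((fun s => (g s).1)^`() t, (fun s => (g s).2)^`() t).

Definition utangent (g : R -> P) (t : R) : P :=
  pscale (pnorm (vel g t))^-1 (vel g t).

Definition smooth_simple_closed_curve (g : R -> P) (L : R) : Prop :=
  [/\ 0 < L,
      smooth_fun (fun t => (g t).1) /\ smooth_fun (fun t => (g t).2),
      (forall t, vel g t != (0, 0)),
      (forall t, g (t + L) = g t) &
      (forall a b, 0 <= a < L -> 0 <= b < L -> g a = g b -> a = b)].

Definition bounded_plane_set (A : set P) : Prop :=
  exists M : R, forall p, A p -> `|p.1| <= M /\ `|p.2| <= M.

(* Omega is a bounded domain (open, connected, bounded) whose topological
   boundary (closure minus Omega, Omega being open) is the trace of g *)
Definition bounded_domain_with_boundary (Om : set P) (g : R -> P) : Prop :=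
  [/\ open Om, connected Om, bounded_plane_set Om, Om !=set0 &
      closure Om `\` Om = range g].

Definition positively_oriented (Om : set P) (g : R -> P) : Prop :=
  forall t, exists e : R, 0 < e /\
    forall h : R, 0 < h < e -> Om (padd (g t) (pscale h (rot90 (utangent g t)))).

Definition is_circle (g : R -> P) : Prop :=
  exists (c : P) (rho : R), 0 < rho /\
    range g = [set p | pnorm (padd p (pscale (-1) c)) = rho].

(* Larmor arc of radius r = 1/beta, unit speed, counterclockwise, starting at
   p with unit velocity v: its centre is p + r * rot90 v. *)
Definition larmor (beta : R) (p v : P) (t : R) : P :=
  padd p (padd (pscale (beta^-1 * sin (beta * t)) v)
               (pscale (beta^-1 * (1 - cos (beta * t))) (rot90 v))).

Definition larmor_vel (beta : R) (v : P) (t : R) : P :=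
  padd (pscale (cos (beta * t)) v) (pscale (sin (beta * t)) (rot90 v)).

Definition entry_dir (g : R -> P) (delta : R) (s : R) : P :=
  padd (pscale (cos delta) (utangent g s))
       (pscale (sin delta) (rot90 (utangent g s))).

Definition gutkin (Om : set P) (g : R -> P) (beta delta : R) : Prop :=
  forall (s t1 s' : R),
    let x := larmor beta (g s) (entry_dir g delta s) in
    0 < t1 ->
    (forall t, 0 < t < t1 -> Om (x t)) ->
    ~ Om (x t1) ->
    g s' = x t1 ->
    dot (larmor_vel beta (entry_dir g delta s) t1) (utangent g s') = cos delta.

End Plane.

(* Main.v *)
From Stdlib Require Import Reals Ranalysis5 Lra Psatz.
From Stdlib Require Import Classical ClassicalEpsilon FunctionalExtensionality.
From Coquelicot Require Import Coquelicot.

(** A Larmor circle entering at angle [delta] is centred at [m - l * e], where [e]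
    is the unit tangent, [m] a curve parallel to the boundary and
    [l = sin delta / beta]; a circle leaving at angle [delta] is centred at
    [m + l * e].  So we want a curve [m], other than a circle, for which the two
    ends of the tangent chord of half-length [l] sweep out the same closed curve
    (Wegner's solutions of the floating body problem).

    If the chord ends [X], [Y] have unit speed while the midpoint moves along the
    chord, and [X] moves in a rotationally symmetric magnetic field whose
    strength is affine in [|X|^2], then [Y] moves in the same field with the same
    conserved quantities, so that [Y] is a rotated time shift of [X].  The orbit
    of [X] is explicit in terms of a phase [chi].  Two applications of the
    intermediate value theorem adjust the gradient [K] of the field, so that the
    orbit has apsidal period [2 PI / n] and hence closes up, and the length [l],
    so that the rotation from [X] to [Y] is a symmetry of the orbit.  For large
    [n] and small amplitude [mu] everything is nearly circular; in particular a
    Larmor circle meets the boundary only in its entry and exit points. *)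

(** The angle enters only through [q = cot delta]: the boundary is the parallel curve of [m] at
    signed distance [l * q], so one family of tracks serves every angle once [l * |q|] is small, and
    [l] is of order [1 / n]. The amplitude [mu] is a fixed positive number for each [n], chosen
    before [K]; the explicit bound on [K * mu] replaces any limiting argument, and [mu > 0] is what
    rules out a circle.

    Why one equation in [l] suffices: start with [X] at a pericentre, where the chord angle is an
    explicit algebraic function of [l]. The distance of [Y] from the origin then fixes the phase of
    [Y], and the conserved quantities fix its velocity relative to its position, up to a sign. Only
    the polar angle remains to be matched, and uniqueness for the equation of motion carries the
    match to all times. A full turn of the phase rotates the orbit by [2 * PI / n], so one such
    rotation may be added to the polar angle; without it the two sides could not be made to cross
    for small [l] by crude bounds. *)

Section BicycleTracks.
Local Open Scope R_scope.

(** * Real analysis *)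

(** [auto_derive] leaves derivatives of abstract functions as [Derive] terms; this replaces them by
    the value known from [h]. *)
Ltac subst_derive h :=
  match type of h with
  | is_derive ?f ?x ?l =>
    repeat match goal with
    | |- context [Derive ?F x] =>
      match F with
      | fun y => ?g y => constr_eq g f; rewrite (is_derive_unique F x l h)
      end
    end
  end.

Ltac ex_derive_by h :=
  match type of h with
  | is_derive ?f ?x ?l =>
    match goal with
    | |- ex_derive (fun y => ?g y) x => constr_eq g f; exact (ex_intro _ l h)
    end
  end.

Lemma derive_nonneg_le (f f' : R -> R) (a b : R) :
  a <= b -> (forall x, a <= x <= b -> is_derive f x (f' x)) ->
  (forall x, a <= x <= b -> 0 <= f' x) -> f a <= f b.
Proof.
intros hab hd hp.
destruct (MVT_gen f a b f') as [c [hc heq]].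
- intros x hx; rewrite Rmin_left, Rmax_right in hx by lra; apply hd; lra.
- intros x hx; rewrite Rmin_left, Rmax_right in hx by lra.
  apply continuity_pt_filterlim, (@ex_derive_continuous _ R_NormedModule).
  now exists (f' x); apply hd.
- rewrite Rmin_left, Rmax_right in hc by lra.
  assert (0 <= f' c * (b - a)) by (apply Rmult_le_pos; [now apply hp|lra]).
  lra.
Qed.

Lemma derive_pos_lt (f f' : R -> R) (a b : R) :
  a < b -> (forall x, a <= x <= b -> is_derive f x (f' x)) ->
  (forall x, a <= x <= b -> 0 < f' x) -> f a < f b.
Proof.
intros hab hd hp.
destruct (MVT_gen f a b f') as [c [hc heq]].
- intros x hx; rewrite Rmin_left, Rmax_right in hx by lra; apply hd; lra.
- intros x hx; rewrite Rmin_left, Rmax_right in hx by lra.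
  apply continuity_pt_filterlim, (@ex_derive_continuous _ R_NormedModule).
  now exists (f' x); apply hd.
- rewrite Rmin_left, Rmax_right in hc by lra.
  assert (0 < f' c * (b - a)) by (apply Rmult_lt_0_compat; [now apply hp|lra]).
  lra.
Qed.

Lemma derive_zero_const (f : R -> R) :
  (forall x : R, is_derive f x 0) -> forall a b, f a = f b.
Proof.
intros hd.
assert (h : forall a b, a <= b -> f a = f b).
{ intros a b hab; apply Rle_antisym.
  - apply (derive_nonneg_le f (fun _ => 0)); auto with real.
  - apply Ropp_le_cancel, (derive_nonneg_le (fun x => - f x) (fun _ => 0)); auto with real.
    intros x _; auto_derive; [now exists 0|].
    subst_derive (hd x); ring. }
intros a b; destruct (Rle_lt_dec a b) as [hab|hab]; [now apply h|].
symmetry; apply h; lra.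
Qed.

Lemma is_derive_continuity_pt (f : R -> R) (x l : R) :
  is_derive f x l -> continuity_pt f x.
Proof.
intros h; apply continuity_pt_filterlim, (@ex_derive_continuous _ R_NormedModule).
now exists l.
Qed.

(** The lower bound on the derivative makes [f] expand distances by at least [c]. This yields
    injectivity, an interval for the intermediate value theorem, and the bound [/ c] on difference
    quotients of the inverse. *)
Lemma inverse_function (f f' : R -> R) (c : R) :
  0 < c -> (forall x : R, is_derive f x (f' x)) -> (forall x, c <= f' x) ->
  exists g : R -> R, (forall y, f (g y) = y) /\ (forall x, g (f x) = x) /\
    (forall y : R, is_derive g y (/ f' (g y))).
Proof.
intros hc hd hf'.
assert (hexp : forall a b, a <= b -> c * (b - a) <= f b - f a).
{ intros a b hab.
  assert (h : f a - c * a <= f b - c * b); [|lra].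
  apply (derive_nonneg_le (fun x => f x - c * x) (fun x => f' x - c)); trivial.
  - intros x _; auto_derive; [now exists (f' x)|].
    subst_derive (hd x); ring.
  - intros x _; specialize (hf' x); lra. }
assert (hexp' : forall a b, c * Rabs (b - a) <= Rabs (f b - f a)).
{ intros a b; destruct (Rle_lt_dec a b) as [h|h].
  - specialize (hexp a b h); rewrite Rabs_pos_eq by lra.
    eapply Rle_trans; [exact hexp|apply Rle_abs].
  - assert (h' : b <= a) by lra; specialize (hexp b a h').
    rewrite <- (Rabs_Ropp (b - a)), <- (Rabs_Ropp (f b - f a)), Rabs_pos_eq by lra.
    eapply Rle_trans; [|apply Rle_abs]; lra. }
assert (hsurj : forall y, {x | f x = y}).
{ intros y; apply constructive_indefinite_description.
  pose (M := Rabs (y - f 0) / c + 1).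
  assert (hM : 0 < M).
  { unfold M; assert (0 <= Rabs (y - f 0) / c); [|lra].
    apply Rmult_le_pos; [apply Rabs_pos|]. left; now apply Rinv_0_lt_compat. }
  assert (hMc : c * M = Rabs (y - f 0) + c) by (unfold M; field; lra).
  assert (h1 : f (- M) < y).
  { assert (h := hexp (- M) 0 ltac:(lra)).
    assert (hh := Rle_abs (- (y - f 0))); rewrite Rabs_Ropp in hh. lra. }
  assert (h2 : y < f M).
  { assert (h := hexp 0 M ltac:(lra)). assert (hh := Rle_abs (y - f 0)). lra. }
  destruct (IVT_interv (fun x => f x - y) (- M) M) as [z [_ hz]]; try lra.
  - intros a _; apply is_derive_continuity_pt with (f' a).
    auto_derive; [now exists (f' a)|].
    subst_derive (hd a); ring.
  - exists z; lra. }
assert (hg : exists g : R -> R, forall y, f (g y) = y).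
{ exists (fun y => proj1_sig (hsurj y)); intros y; exact (proj2_sig (hsurj y)). }
clear hsurj; destruct hg as [g hfg]; exists g.
split; [exact hfg|]; split.
- intros x; assert (h := hexp' x (g (f x))); rewrite hfg, Rminus_diag, Rabs_R0 in h.
  destruct (Req_dec (g (f x) - x) 0) as [h0|h0]; [lra|].
  assert (0 < Rabs (g (f x) - x)) by now apply Rabs_pos_lt.
  assert (0 < c * Rabs (g (f x) - x)) by now apply Rmult_lt_0_compat.
  lra.
- intros y.
  assert (hp : 0 < f' (g y)) by (specialize (hf' (g y)); lra).
  apply is_derive_Reals; intros eps heps.
  assert (hd' := proj1 (is_derive_Reals _ _ _) (hd (g y))).
  assert (he : 0 < eps * c * f' (g y)) by (apply Rmult_lt_0_compat; [now apply Rmult_lt_0_compat|easy]).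
  destruct (hd' _ he) as [d hd2].
  assert (hdc : 0 < c * d) by (apply Rmult_lt_0_compat; [easy|apply cond_pos]).
  exists (mkposreal _ hdc); simpl; intros h hn0 hh.
  set (k := g (y + h) - g y).
  assert (hk : f (g y + k) - f (g y) = h).
  { unfold k; replace (g y + (g (y + h) - g y)) with (g (y + h)) by ring.
    rewrite !hfg; ring. }
  assert (hk0 : k <> 0).
  { intros h0; rewrite h0, Rplus_0_r in hk; lra. }
  assert (hkh : c * Rabs k <= Rabs h).
  { assert (hq := hexp' (g y) (g y + k)); rewrite hk in hq.
    now replace (g y + k - g y) with k in hq by ring. }
  assert (hkd : Rabs k < d).
  { apply Rmult_lt_reg_l with c; [easy|lra]. }
  specialize (hd2 k hk0 hkd); rewrite hk in hd2.
  fold k.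
  replace (k / h - / f' (g y)) with (- (h / k - f' (g y)) * (k / (h * f' (g y))))
    by (field; lra).
  rewrite Rabs_mult, Rabs_Ropp.
  assert (hah : 0 < Rabs h) by now apply Rabs_pos_lt.
  assert (hq : Rabs (k / (h * f' (g y))) <= / (c * f' (g y))).
  { unfold Rdiv; rewrite Rabs_mult, Rabs_inv, Rabs_mult, (Rabs_pos_eq (f' (g y))) by lra.
    apply Rmult_le_reg_l with (c * f' (g y) * Rabs h).
    - apply Rmult_lt_0_compat; [now apply Rmult_lt_0_compat|easy].
    - replace (c * f' (g y) * Rabs h * (Rabs k * / (Rabs h * f' (g y)))) with (c * Rabs k) by (field; lra).
      replace (c * f' (g y) * Rabs h * / (c * f' (g y))) with (Rabs h) by (field; lra).
      exact hkh. }
  apply Rle_lt_trans with (Rabs (h / k - f' (g y)) * / (c * f' (g y))).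
  + apply Rmult_le_compat_l; [apply Rabs_pos|exact hq].
  + apply Rlt_le_trans with (eps * c * f' (g y) * / (c * f' (g y))).
    * apply Rmult_lt_compat_r; [apply Rinv_0_lt_compat; now apply Rmult_lt_0_compat|exact hd2].
    * right; field; lra.
Qed.

(** [Z * exp (- C * t)] cannot grow forwards in time, and [Z * exp (C * t)] cannot grow
    backwards. *)
Lemma gronwall_zero (Z Z' : R -> R) (C : R) :
  (forall t : R, is_derive Z t (Z' t)) -> (forall t, 0 <= Z t) ->
  (forall t, Rabs (Z' t) <= C * Z t) -> Z 0 = 0 -> forall t, Z t = 0.
Proof.
intros hd hp hb h0 t; apply Rle_antisym; [|apply hp].
destruct (Rle_lt_dec 0 t) as [ht|ht].
- assert (h : - (Z 0 * exp (- C * 0)) <= - (Z t * exp (- C * t))).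
  { apply (derive_nonneg_le (fun s => - (Z s * exp (- C * s)))
      (fun s => (C * Z s - Z' s) * exp (- C * s))); trivial; intros s _.
    - auto_derive; [now exists (Z' s)|]; subst_derive (hd s); ring.
    - apply Rmult_le_pos; [|left; apply exp_pos].
      assert (h1 := hb s); assert (h2 := Rle_abs (Z' s)); lra. }
  rewrite h0, Rmult_0_l in h; assert (he := exp_pos (- C * t)).
  apply Rmult_le_reg_r with (exp (- C * t)); lra.
- assert (h : Z t * exp (C * t) <= Z 0 * exp (C * 0)).
  { apply (derive_nonneg_le (fun s => Z s * exp (C * s))
      (fun s => (C * Z s + Z' s) * exp (C * s))); try lra; intros s _.
    - auto_derive; [now exists (Z' s)|]; subst_derive (hd s); ring.
    - apply Rmult_le_pos; [|left; apply exp_pos].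
      assert (h1 := hb s); assert (h2 := Rle_abs (- Z' s)); rewrite Rabs_Ropp in h2; lra. }
  rewrite h0, Rmult_0_l in h; assert (he := exp_pos (C * t)).
  apply Rmult_le_reg_r with (exp (C * t)); lra.
Qed.

(** Gronwall for the squared distance [Z] in phase space. The field along the first orbit merely
    rotates the velocity difference, so fields enter [Z'] only through their difference, which is
    Lipschitz in the position on the disc given by [M]. *)
Lemma magnetic_unique (c0 c1 M : R) (x1 y1 u1 v1 x2 y2 u2 v2 : R -> R) :
  1 <= M ->
  (forall t : R, is_derive x1 t (u1 t)) -> (forall t : R, is_derive y1 t (v1 t)) ->
  (forall t : R, is_derive u1 t (- (c0 + c1 * (x1 t ^ 2 + y1 t ^ 2)) * v1 t)) ->
  (forall t : R, is_derive v1 t ((c0 + c1 * (x1 t ^ 2 + y1 t ^ 2)) * u1 t)) ->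
  (forall t : R, is_derive x2 t (u2 t)) -> (forall t : R, is_derive y2 t (v2 t)) ->
  (forall t : R, is_derive u2 t (- (c0 + c1 * (x2 t ^ 2 + y2 t ^ 2)) * v2 t)) ->
  (forall t : R, is_derive v2 t ((c0 + c1 * (x2 t ^ 2 + y2 t ^ 2)) * u2 t)) ->
  (forall t, u2 t ^ 2 + v2 t ^ 2 = 1) ->
  (forall t, x1 t ^ 2 + y1 t ^ 2 <= M) -> (forall t, x2 t ^ 2 + y2 t ^ 2 <= M) ->
  x1 0 = x2 0 -> y1 0 = y2 0 -> u1 0 = u2 0 -> v1 0 = v2 0 ->
  forall t, x1 t = x2 t /\ y1 t = y2 t.
Proof.
intros hM hx1 hy1 hu1 hv1 hx2 hy2 hu2 hv2 hn hb1 hb2 ix iy iu iv.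
pose (Z := fun t => (x1 t - x2 t) ^ 2 + (y1 t - y2 t) ^ 2 + (u1 t - u2 t) ^ 2 + (v1 t - v2 t) ^ 2).
pose (K := fun t => c1 * ((x1 t - x2 t) * (x1 t + x2 t) + (y1 t - y2 t) * (y1 t + y2 t))).
pose (B := fun t => (v1 t - v2 t) * u2 t - (u1 t - u2 t) * v2 t).
pose (Z' := fun t => 2 * ((x1 t - x2 t) * (u1 t - u2 t) + (y1 t - y2 t) * (v1 t - v2 t)) + 2 * (K t * B t)).
assert (hZ : forall t, Z t = 0).
{ apply (gronwall_zero Z Z' (1 + 4 * M * Rabs c1)).
  - intros t; unfold Z, Z', K, B; auto_derive.
    + repeat split; eexists; eauto.
    + subst_derive (hx1 t); subst_derive (hx2 t); subst_derive (hy1 t); subst_derive (hy2 t).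
      subst_derive (hu1 t); subst_derive (hu2 t); subst_derive (hv1 t); subst_derive (hv2 t).
      ring.
  - intros t; unfold Z; repeat apply Rplus_le_le_0_compat; apply pow2_ge_0.
  - intros t; unfold Z'.
    set (dx := x1 t - x2 t); set (dy := y1 t - y2 t); set (du := u1 t - u2 t); set (dv := v1 t - v2 t).
    assert (eZ : Z t = dx ^ 2 + dy ^ 2 + (du ^ 2 + dv ^ 2)) by (unfold Z, dx, dy, du, dv; ring).
    set (A := dx * (x1 t + x2 t) + dy * (y1 t + y2 t)).
    assert (eK : K t = c1 * A) by reflexivity.
    assert (hA : A ^ 2 <= 4 * M * (dx ^ 2 + dy ^ 2)).
    { assert (hs : (x1 t + x2 t) ^ 2 + (y1 t + y2 t) ^ 2 <= 4 * M).
      { specialize (hb1 t); specialize (hb2 t).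
        assert (0 <= (x1 t - x2 t) ^ 2) by apply pow2_ge_0.
        assert (0 <= (y1 t - y2 t) ^ 2) by apply pow2_ge_0. nra. }
      assert (A ^ 2 <= (dx ^ 2 + dy ^ 2) * ((x1 t + x2 t) ^ 2 + (y1 t + y2 t) ^ 2)).
      { assert (0 <= (dx * (y1 t + y2 t) - dy * (x1 t + x2 t)) ^ 2) by apply pow2_ge_0.
        unfold A; nra. }
      assert (0 <= dx ^ 2 + dy ^ 2) by (apply Rplus_le_le_0_compat; apply pow2_ge_0). nra. }
    assert (hB : B t ^ 2 <= du ^ 2 + dv ^ 2).
    { assert (0 <= (du * u2 t + dv * v2 t) ^ 2) by apply pow2_ge_0.
      specialize (hn t); unfold B; fold du; fold dv.
      replace ((dv * u2 t - du * v2 t) ^ 2) with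
        ((du ^ 2 + dv ^ 2) * (u2 t ^ 2 + v2 t ^ 2) - (du * u2 t + dv * v2 t) ^ 2) by ring.
      rewrite hn; lra. }
    assert (h1 : Rabs (2 * (dx * du + dy * dv)) <= Z t).
    { rewrite eZ; apply Rabs_le; split.
      - assert (0 <= (dx + du) ^ 2) by apply pow2_ge_0.
        assert (0 <= (dy + dv) ^ 2) by apply pow2_ge_0. nra.
      - assert (0 <= (dx - du) ^ 2) by apply pow2_ge_0.
        assert (0 <= (dy - dv) ^ 2) by apply pow2_ge_0. nra. }
    assert (h2 : Rabs (2 * (A * B t)) <= 4 * M * Z t).
    { assert (0 <= du ^ 2 + dv ^ 2) by (apply Rplus_le_le_0_compat; apply pow2_ge_0).
      assert (A ^ 2 + B t ^ 2 <= 4 * M * Z t) by (rewrite eZ; nra).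
      apply Rabs_le; split.
      - assert (0 <= (A + B t) ^ 2) by apply pow2_ge_0. nra.
      - assert (0 <= (A - B t) ^ 2) by apply pow2_ge_0. nra. }
    eapply Rle_trans; [apply Rabs_triang|].
    rewrite eK; replace (2 * (c1 * A * B t)) with (c1 * (2 * (A * B t))) by ring.
    rewrite (Rabs_mult c1).
    assert (h3 := Rmult_le_compat_l _ _ _ (Rabs_pos c1) h2). lra.
  - unfold Z; rewrite ix, iy, iu, iv; ring. }
intros t; specialize (hZ t); unfold Z in hZ.
assert (a1 := pow2_ge_0 (x1 t - x2 t)); assert (a2 := pow2_ge_0 (y1 t - y2 t)).
assert (a3 := pow2_ge_0 (u1 t - u2 t)); assert (a4 := pow2_ge_0 (v1 t - v2 t)).
split; apply Rminus_diag_uniq, Rsqr_0_uniq; unfold Rsqr; simpl in *; lra.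
Qed.

(** * The closed orbit *)

Lemma continuity_RInt_param (f : R -> R -> R) (a b c d x : R) :
  c <= d -> a < x < b ->
  (forall u v, a <= u <= b -> c <= v <= d -> continuity_2d_pt f u v) ->
  continuity_pt (fun u => RInt (f u) c d) x.
Proof.
intros hcd hx hf.
assert (hex : forall u, a <= u <= b -> ex_RInt (f u) c d).
{ intros u hu; apply (@ex_RInt_continuous R_CompleteNormedModule); intros v hv.
  rewrite Rmin_left, Rmax_right in hv by lra.
  apply continuity_pt_filterlim; intros eps heps.
  destruct (hf u v hu hv (mkposreal eps heps)) as [d' hd'].
  exists d'; split; [apply cond_pos|]; intros w [_ hw].
  apply (hd' u w); [rewrite Rminus_diag, Rabs_R0; apply cond_pos|exact hw]. }
intros eps heps.
assert (he : 0 < eps / (2 * (d - c + 1))) by (apply Rdiv_lt_0_compat; lra).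
destruct (uniform_continuity_2d f a b c d hf (mkposreal _ he)) as [r hr]; simpl in hr.
assert (hm : 0 < Rmin r (Rmin (x - a) (b - x)))
  by (repeat apply Rmin_pos; [apply cond_pos|lra|lra]).
exists (Rmin r (Rmin (x - a) (b - x))); split; [exact hm|].
intros y [_ hy]; simpl in hy; unfold R_dist in hy.
assert (hyr := Rlt_le_trans _ _ _ hy (Rmin_l _ _)).
assert (hy' := Rlt_le_trans _ _ _ hy (Rmin_r _ _)).
assert (hya := Rlt_le_trans _ _ _ hy' (Rmin_l _ _)).
assert (hyb := Rlt_le_trans _ _ _ hy' (Rmin_r _ _)).
apply Rabs_def2 in hya; apply Rabs_def2 in hyb.
simpl; unfold R_dist.
assert (e : RInt (f y) c d - RInt (f x) c d = RInt (fun v => f y v - f x v) c d).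
{ symmetry; apply (RInt_minus (V := R_CompleteNormedModule)); apply hex; lra. }
rewrite e.
apply Rle_lt_trans with ((d - c) * (eps / (2 * (d - c + 1)))).
- apply abs_RInt_le_const; [easy| |].
  + apply (ex_RInt_minus (V := R_NormedModule)); apply hex; lra.
  + intros v hv; left; apply hr; try lra.
    rewrite Rminus_diag, Rabs_R0; apply cond_pos.
- apply Rmult_lt_reg_r with (2 * (d - c + 1)); [lra|].
  replace ((d - c) * (eps / (2 * (d - c + 1))) * (2 * (d - c + 1))) with ((d - c) * eps) by (field; lra).
  nra.
Qed.

(* Squared radius and angular momentum of the orbit as functions of its phase
   [x]; [speed] is the time derivative of the phase, obtained by factoring
   [rad2 - moment ^ 2 = (mu * cos x) ^ 2 * speed2]. *)
Definition rad2 (mu x : R) : R := 1 + mu ^ 2 + 2 * mu * sin x.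
Definition moment (mu K x : R) : R := 1 + mu * sin x - K / 2 * mu ^ 2 * cos x ^ 2.
Definition speed2 (mu K x : R) : R := 1 + K * (1 + mu * sin x) - K ^ 2 / 4 * mu ^ 2 * cos x ^ 2.
Definition speed (mu K x : R) : R := sqrt (speed2 mu K x).
Definition rate (mu K x : R) : R := moment mu K x / (rad2 mu x * speed mu K x).
Definition polar (mu K x : R) : R := RInt (rate mu K) (- PI / 2) x.

Lemma sin2_cos2_pow (x : R) : sin x ^ 2 + cos x ^ 2 = 1.
Proof. rewrite <- (sin2_cos2 x); unfold Rsqr; ring. Qed.

Lemma rad2_bounds (mu x : R) : 0 < mu < 1 -> (1 - mu) ^ 2 <= rad2 mu x <= (1 + mu) ^ 2.
Proof. intros h; unfold rad2; destruct (SIN_bound x); nra. Qed.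

(** [K] may be large, but [1 + K] is perturbed only through [K * mu]: by at most 1/8 in the sine
    term and 1/256 in the squared one. *)
Lemma speed2_bounds (mu K x : R) : 0 < mu < 1 -> 0 <= K -> K * mu <= 1 / 8 ->
  K + 6 / 7 <= speed2 mu K x <= K + 9 / 8.
Proof.
intros h hK hm; unfold speed2; destruct (SIN_bound x).
assert (hc : 0 <= cos x ^ 2 <= 1) by (assert (h1 := sin2_cos2_pow x); nra).
assert (0 <= K * mu) by nra.
assert (- (K * mu) <= K * mu * sin x <= K * mu) by nra.
assert (0 <= (K * mu) ^ 2 * cos x ^ 2 <= (K * mu) ^ 2) by nra.
split; nra.
Qed.

Lemma speed_pos (mu K x : R) : 0 < mu < 1 -> 0 <= K -> K * mu <= 1 / 8 -> 0 < speed mu K x.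
Proof.
intros h hK hm; apply sqrt_lt_R0; destruct (speed2_bounds mu K x h hK hm).
assert (0 <= K * mu) by nra. nra.
Qed.

Lemma moment_bounds (mu K x : R) : 0 < mu < 1 -> 0 <= K -> K * mu <= 1 / 8 ->
  1 - mu - K * mu * mu / 2 <= moment mu K x <= 1 + mu.
Proof.
intros h hK hm; unfold moment; destruct (SIN_bound x).
assert (hc : 0 <= cos x ^ 2 <= 1) by (assert (h1 := sin2_cos2_pow x); nra).
assert (0 <= K * mu * mu) by nra.
assert (0 <= K * mu * mu * cos x ^ 2 <= K * mu * mu) by nra.
split; nra.
Qed.

Lemma rate_continuity_2d (mu K x : R) : 0 < mu < 1 -> 0 <= K -> K * mu <= 1 / 8 ->
  continuity_2d_pt (rate mu) K x.
Proof.
intros h hK hm.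
assert (hw := rad2_bounds mu x h); assert (hD := speed_pos mu K x h hK hm).
assert (hs : continuity_2d_pt (fun _ v => sin v) K x)
  by (apply (continuity_1d_2d_pt_comp sin (fun _ v => v)); [apply continuity_sin|apply continuity_2d_pt_id2]).
assert (hc : continuity_2d_pt (fun _ v => cos v) K x)
  by (apply (continuity_1d_2d_pt_comp cos (fun _ v => v)); [apply continuity_cos|apply continuity_2d_pt_id2]).
unfold rate, Rdiv; apply continuity_2d_pt_mult.
- unfold moment, Rdiv; simpl.
  repeat first [assumption | apply continuity_2d_pt_minus | apply continuity_2d_pt_plus
    | apply continuity_2d_pt_mult | apply continuity_2d_pt_id1 | apply continuity_2d_pt_const].
- apply continuity_2d_pt_inv; [|apply Rgt_not_eq, Rmult_lt_0_compat; nra].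
  apply continuity_2d_pt_mult.
  + unfold rad2; simpl.
    repeat first [assumption | apply continuity_2d_pt_minus | apply continuity_2d_pt_plus
      | apply continuity_2d_pt_mult | apply continuity_2d_pt_id1 | apply continuity_2d_pt_const].
  + apply (continuity_1d_2d_pt_comp sqrt (speed2 mu)).
    * apply continuity_pt_sqrt. destruct (speed2_bounds mu K x h hK hm).
      assert (0 <= K * mu) by nra. nra.
    * unfold speed2, Rdiv; simpl.
      repeat first [assumption | apply continuity_2d_pt_minus | apply continuity_2d_pt_plus
        | apply continuity_2d_pt_mult | apply continuity_2d_pt_id1 | apply continuity_2d_pt_const].
Qed.

Lemma rate_continuous (mu K x : R) : 0 < mu < 1 -> 0 <= K -> K * mu <= 1 / 8 ->
  continuous (rate mu K) x.
Proof.
intros h hK hm; apply continuity_pt_filterlim; intros eps heps.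
destruct (rate_continuity_2d mu K x h hK hm (mkposreal eps heps)) as [d' hd'].
exists d'; split; [apply cond_pos|]; intros w [_ hw].
apply (hd' K w); [rewrite Rminus_diag, Rabs_R0; apply cond_pos|exact hw].
Qed.

Lemma is_derive_polar (mu K x : R) : 0 < mu < 1 -> 0 <= K -> K * mu <= 1 / 8 ->
  is_derive (polar mu K) x (rate mu K x).
Proof.
intros h hK hm; apply (is_derive_RInt (rate mu K) (polar mu K) (- PI / 2) x).
- apply filter_forall; intros y; apply (RInt_correct (V := R_CompleteNormedModule)).
  apply (@ex_RInt_continuous R_CompleteNormedModule); intros z _; now apply rate_continuous.
- now apply rate_continuous.
Qed.

(* At the end points of the parameter interval the radial frequency is close to
   [n - 1] and [n + 1], so a crude perturbation estimate is enough. *)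
Lemma exists_closing (n mu : R) : 32 <= n -> mu = / (16 * (n ^ 2 + 2 * n)) ->
  exists K, n ^ 2 - 2 * n <= K <= n ^ 2 + 2 * n /\ polar mu K (3 * PI / 2) = 2 * PI / n.
Proof.
intros hn hmu.
set (N := n ^ 2 + 2 * n) in *.
assert (hN : 1088 <= N) by (unfold N; nra).
assert (hmN : mu * N = 1 / 16) by (rewrite hmu; field; lra).
assert (hmu0 : 0 < mu) by (rewrite hmu; apply Rinv_0_lt_compat; lra).
assert (hmu1 : mu < 1 / 1000) by nra.
assert (hnm : n * mu <= 1 / 512) by (unfold N in hmN; nra).
assert (hPI := PI_RGT_0).
set (f := fun K => polar mu K (3 * PI / 2) - 2 * PI / n).
(* With the target written as an integral, both end point inequalities become pointwise comparisons
   of [rate] with [/ n]. *)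
assert (e0 : 2 * PI / n = RInt (fun _ => / n) (- PI / 2) (3 * PI / 2)).
{ rewrite RInt_const. unfold scal; simpl; unfold mult; simpl. field; lra. }
assert (hcont : forall K, 0 <= K -> K * mu <= 1 / 8 -> forall x, continuous (rate mu K) x)
  by (intros; apply rate_continuous; lra).
destruct (IVT_interv (fun K => - f K) (n ^ 2 - 2 * n) N) as [K [hK hf]].
- intros K hK. apply continuity_pt_opp, continuity_pt_minus; [|apply continuity_pt_const; now intros ? ?].
  (* The larger interval keeps [K] interior; [u * mu] stays below 1/8 on it. *)
  apply (continuity_RInt_param (rate mu) 0 (N + 1)); [lra|nra|].
  intros u v hu _; apply rate_continuity_2d; nra.
- unfold N; lra.
- cut (2 * PI / n < polar mu (n ^ 2 - 2 * n) (3 * PI / 2)); [unfold f; lra|].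
  rewrite e0; unfold polar; apply RInt_lt; [lra| | |].
  + intros x _; apply hcont; unfold N in *; nra.
  + intros x _; apply continuous_const.
  + intros x _; unfold rate.
    set (K := n ^ 2 - 2 * n).
    assert (hK0 : 0 <= K) by (unfold K; nra).
    assert (hKm : K * mu <= 1 / 16) by (unfold K, N in *; nra).
    assert (hw := rad2_bounds mu x ltac:(lra)).
    assert (hP := moment_bounds mu K x ltac:(lra) hK0 ltac:(lra)).
    assert (hD := speed_pos mu K x ltac:(lra) hK0 ltac:(lra)).
    (* Here [1 + K = (n - 1) ^ 2], so [K + 9 / 8] lies below [(n - 1 / 2) ^ 2]. *)
    assert (hD2 : speed mu K x <= n - 1 / 2).
    { unfold speed; replace (n - 1 / 2) with (sqrt ((n - 1 / 2) ^ 2)) by (apply sqrt_pow2; lra).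
      apply sqrt_le_1_alt. destruct (speed2_bounds mu K x ltac:(lra) hK0 ltac:(lra)). unfold K in *; nra. }
    set (D := speed mu K x) in *; set (w := rad2 mu x) in *; set (P := moment mu K x) in *.
    assert (hw0 : 0 < w) by nra.
    assert (hP' : 1 - 2 * mu <= P) by nra.
    assert (hwD : w * D <= (1 + 3 * mu) * (n - 1 / 2)).
    { apply Rmult_le_compat; try lra. nra. }
    apply Rmult_lt_reg_r with (w * D * n); [repeat apply Rmult_lt_0_compat; lra|].
    replace (/ n * (w * D * n)) with (w * D) by (field; lra).
    replace (P / (w * D) * (w * D * n)) with (P * n) by (field; lra).
    nra.
- cut (polar mu N (3 * PI / 2) < 2 * PI / n); [unfold f; lra|].
  rewrite e0; unfold polar; apply RInt_lt; [lra| | |].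
  + intros x _; apply continuous_const.
  + intros x _; apply hcont; unfold N in *; nra.
  + intros x _; unfold rate.
    assert (hK0 : 0 <= N) by lra.
    assert (hKm : N * mu <= 1 / 16) by lra.
    assert (hw := rad2_bounds mu x ltac:(lra)).
    assert (hP := moment_bounds mu N x ltac:(lra) hK0 ltac:(lra)).
    assert (hD2 : n + 1 / 2 <= speed mu N x).
    { unfold speed; replace (n + 1 / 2) with (sqrt ((n + 1 / 2) ^ 2)) by (apply sqrt_pow2; lra).
      apply sqrt_le_1_alt. destruct (speed2_bounds mu N x ltac:(lra) hK0 ltac:(lra)).
      assert ((N * mu) ^ 2 <= 1) by nra. unfold N in *; nra. }
    set (D := speed mu N x) in *; set (w := rad2 mu x) in *; set (P := moment mu N x) in *.
    assert (hw0 : 0 < w) by nra.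
    assert (hP' : P <= 1 + mu) by nra.
    assert (hwD : (1 - 2 * mu) * (n + 1 / 2) <= w * D).
    { apply Rmult_le_compat; try lra. nra. }
    apply Rmult_lt_reg_r with (w * D * n); [repeat apply Rmult_lt_0_compat; lra|].
    replace (/ n * (w * D * n)) with (w * D) by (field; lra).
    replace (P / (w * D) * (w * D * n)) with (P * n) by (field; lra).
    nra.
- exists K; split; [exact hK|unfold f in hf; lra].
Qed.

Lemma polar_shift (mu K a : R) : 0 < mu < 1 -> 0 <= K -> K * mu <= 1 / 8 ->
  polar mu K (3 * PI / 2) = a -> forall x, polar mu K (x + 2 * PI) = polar mu K x + a.
Proof.
intros h hK hm ha x.
assert (hd : forall y : R, is_derive (fun z => polar mu K (z + 2 * PI) - polar mu K z) y 0).
{ intros y; assert (h1 := is_derive_polar mu K (y + 2 * PI) h hK hm).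
  assert (h2 := is_derive_polar mu K y h hK hm).
  auto_derive; [repeat split; eexists; eauto|].
  subst_derive h1; subst_derive h2.
  unfold rate, moment, rad2, speed, speed2; rewrite sin_plus, cos_plus, sin_2PI, cos_2PI.
  replace (sin y * 1 + cos y * 0) with (sin y) by ring.
  replace (cos y * 1 - sin y * 0) with (cos y) by ring. ring. }
assert (e := derive_zero_const _ hd x (- PI / 2)); cbv beta in e.
replace (- PI / 2 + 2 * PI) with (3 * PI / 2) in e by field.
assert (e0 : polar mu K (- PI / 2) = 0) by (unfold polar; now rewrite RInt_point).
rewrite ha, e0 in e; lra.
Qed.

(** The phase equation is autonomous: time as a function of the phase is the integral of [/ speed],
    and it can be inverted because [speed] is bounded above. [T] is the time of one phase turn. *)
Lemma exists_phase (mu K : R) : 0 < mu < 1 -> 0 <= K -> K * mu <= 1 / 8 ->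
  exists (chi : R -> R) (T : R), 0 < T /\ chi 0 = - PI / 2 /\
    (forall t : R, is_derive chi t (speed mu K (chi t))) /\
    (forall t, chi (t + T) = chi t + 2 * PI) /\ (forall x, exists t, chi t = x).
Proof.
intros h hK hm.
set (f := fun x => RInt (fun y => / speed mu K y) (- PI / 2) x).
assert (hc : forall x, continuous (fun y => / speed mu K y) x).
{ intros x; assert (hs := speed_pos mu K x h hK hm).
  apply (@ex_derive_continuous _ R_NormedModule).
  unfold speed, speed2 in *; auto_derive; split; trivial.
  - destruct (Rle_lt_dec (1 + K * (1 + mu * sin x) - K ^ 2 / 4 * mu ^ 2 * cos x ^ 2) 0) as [h0|h0].
    + rewrite sqrt_neg_0 in hs; lra.
    + simpl in h0 |- *; unfold Rdiv in h0; lra.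
  - simpl in hs |- *; unfold Rdiv, Rminus in hs |- *; split; trivial; lra. }
assert (hf : forall x : R, is_derive f x (/ speed mu K x)).
{ intros x; apply (is_derive_RInt (fun y => / speed mu K y) f (- PI / 2) x); [|apply hc].
  apply filter_forall; intros y; apply (RInt_correct (V := R_CompleteNormedModule)).
  now apply (@ex_RInt_continuous R_CompleteNormedModule). }
assert (hb : forall x, / sqrt (K + 9 / 8) <= / speed mu K x).
{ intros x; apply Rinv_le_contravar; [now apply speed_pos|].
  apply sqrt_le_1_alt; now apply speed2_bounds. }
assert (hl : 0 < / sqrt (K + 9 / 8)) by (apply Rinv_0_lt_compat, sqrt_lt_R0; nra).
destruct (inverse_function f (fun x => / speed mu K x) _ hl hf hb) as [chi [h1 [h2 h3]]].
assert (hshift : forall x, f (x + 2 * PI) = f x + f (3 * PI / 2)).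
{ intros x.
  assert (hd : forall y : R, is_derive (fun z => f (z + 2 * PI) - f z) y 0).
  { intros y; assert (g1 := hf (y + 2 * PI)); assert (g2 := hf y).
    auto_derive; [repeat split; eexists; eauto|].
    subst_derive g1; subst_derive g2.
    unfold speed, speed2; rewrite sin_plus, cos_plus, sin_2PI, cos_2PI.
    replace (sin y * 1 + cos y * 0) with (sin y) by ring.
    replace (cos y * 1 - sin y * 0) with (cos y) by ring. ring. }
  assert (e := derive_zero_const _ hd x (- PI / 2)); cbv beta in e.
  replace (- PI / 2 + 2 * PI) with (3 * PI / 2) in e by field.
  assert (e0 : f (- PI / 2) = 0) by (unfold f; now rewrite RInt_point).
  rewrite e0 in e; lra. }
assert (hPI := PI_RGT_0).
assert (e0 : f (- PI / 2) = 0) by (unfold f; now rewrite RInt_point).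
exists chi, (f (3 * PI / 2)); split; [|split; [|split; [|split]]].
- rewrite <- e0; apply (derive_pos_lt f (fun x => / speed mu K x)); [lra|auto|].
  intros x _; specialize (hb x); lra.
- now rewrite <- e0, h2.
- intros t; rewrite <- (Rinv_inv (speed mu K (chi t))); apply h3.
- intros t. rewrite <- (h1 t) at 1; now rewrite <- hshift, h2.
- intros x; exists (f x); apply h2.
Qed.

(** * Equations of motion of the orbit *)

Section Oval.
Variables (mu K : R) (chi : R -> R).
Hypothesis hmu : 0 < mu <= 1 / 240.
Hypothesis hK : 15 <= K.
Hypothesis hKmu : K * mu <= 1 / 16.
Hypothesis hchi : forall t : R, is_derive chi t (speed mu K (chi t)).

(* With [X = (oX, oY)] at time [t]: [ow = |X|^2], [oP = X x X'], [oS = X . X'],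
   [okap] is the curvature and [opsi] the polar angle; [(oU, oV)] is [X']. *)
Definition ow t := rad2 mu (chi t).
Definition oP t := moment mu K (chi t).
Definition oS t := mu * cos (chi t) * speed mu K (chi t).
Definition okap t := 1 + K * mu * sin (chi t).
Definition opsi t := polar mu K (chi t).
Definition oX t := sqrt (ow t) * cos (opsi t).
Definition oY t := sqrt (ow t) * sin (opsi t).
Definition oU t := (oS t * oX t - oP t * oY t) / ow t.
Definition oV t := (oS t * oY t + oP t * oX t) / ow t.

Let hmu1 : 0 < mu < 1. Proof. lra. Qed.
Let hK0 : 0 <= K. Proof. lra. Qed.
Let hKm : K * mu <= 1 / 8. Proof. lra. Qed.

Lemma speed_sq t : speed mu K (chi t) ^ 2 = speed2 mu K (chi t).
Proof.
unfold speed; rewrite pow2_sqrt; trivial.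
destruct (speed2_bounds mu K (chi t) hmu1 hK0 hKm); nra.
Qed.

Lemma ow_bounds t : 98 / 100 <= ow t <= 102 / 100.
Proof. destruct (rad2_bounds mu (chi t) hmu1); unfold ow; nra. Qed.

Lemma oP_bounds t : 99 / 100 <= oP t <= 101 / 100.
Proof. destruct (moment_bounds mu K (chi t) hmu1 hK0 hKm); unfold oP; assert (K * mu * mu <= 1 / 16 * mu) by nra; lra. Qed.

(** [speed] grows like the square root of [K], but [mu ^ 2 * K = mu * (K * mu)] is small. *)
Lemma oS_bounds t : - (1 / 50) <= oS t <= 1 / 50.
Proof.
assert (h : oS t ^ 2 <= (1 / 50) ^ 2).
{ unfold oS; rewrite !Rpow_mult_distr, speed_sq.
  destruct (speed2_bounds mu K (chi t) hmu1 hK0 hKm) as [h1 h2].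
  assert (hc : 0 <= cos (chi t) ^ 2 <= 1) by (assert (h3 := sin2_cos2_pow (chi t)); nra).
  assert (h4 : 0 <= speed2 mu K (chi t)) by nra.
  assert (h5 : mu ^ 2 * speed2 mu K (chi t) <= (1 / 50) ^ 2).
  { apply Rle_trans with (mu ^ 2 * (K + 9 / 8)); [apply Rmult_le_compat_l; nra|].
    replace (mu ^ 2 * (K + 9 / 8)) with (mu * (9 / 8 * mu + K * mu)) by ring. nra. }
  assert (0 <= mu ^ 2 * speed2 mu K (chi t)) by (apply Rmult_le_pos; nra).
  nra. }
split; nra.
Qed.

(** Lagrange's identity for a unit velocity; [speed2] is the cofactor that makes it true. *)
Lemma oSP t : oS t ^ 2 + oP t ^ 2 = ow t.
Proof.
unfold oS; rewrite !Rpow_mult_distr, speed_sq.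
unfold oP, moment, ow, rad2, speed2.
assert (h := sin2_cos2_pow (chi t)).
replace (cos (chi t) ^ 2) with (1 - sin (chi t) ^ 2) by lra. field.
Qed.

Lemma okapE t : okap t = 1 + K / 2 * (ow t - 1 - mu ^ 2).
Proof. unfold okap, ow, rad2; field. Qed.

Lemma okap_bounds t : 15 / 16 <= okap t <= 17 / 16.
Proof.
unfold okap; destruct (SIN_bound (chi t)); assert (0 <= K * mu) by nra; split; nra.
Qed.

Lemma ow_derive (t : R) : is_derive ow t (2 * oS t).
Proof.
unfold ow, rad2; auto_derive; [eexists; eauto|].
subst_derive (hchi t); unfold oS; ring.
Qed.

Lemma okap_derive (t : R) : is_derive okap t (K * oS t).
Proof.
unfold okap; auto_derive; [eexists; eauto|].
subst_derive (hchi t); unfold oS; ring.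
Qed.

(** A conservation law in disguise: since [ow] has derivative [2 * oS], [oP] is
    [w / 2 + K / 8 * (w - 1 - mu ^ 2) ^ 2] plus a constant, with [w = ow t]. The constant puts the
    apsides at radii [1 - mu] and [1 + mu]. *)
Lemma oP_derive (t : R) : is_derive oP t (okap t * oS t).
Proof.
unfold oP, moment; auto_derive; [repeat split; eexists; eauto|].
subst_derive (hchi t); unfold oS, okap; field.
Qed.

Lemma oS_derive (t : R) : is_derive oS t (1 - okap t * oP t).
Proof.
assert (hp := speed_pos mu K (chi t) hmu1 hK0 hKm).
assert (hs := speed_sq t).
assert (hp2 : 0 < speed2 mu K (chi t)) by (rewrite <- hs; nra).
(* Along the orbit the derivative of [speed] is free of square roots: the factor [chi' = speed]
   cancels the denominator. With [D] opaque, only its square has to be expanded. *)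
pose (D := fun s : R => speed mu K (chi s)).
assert (hD : is_derive D t
  (K * mu * cos (chi t) / 2 + K ^ 2 * mu ^ 2 / 4 * cos (chi t) * sin (chi t))).
{ unfold D, speed at 1; unfold speed2 at 1; auto_derive.
  - repeat split; try (now eexists; eauto).
    eapply Rlt_le_trans; [exact hp2|right; unfold speed2; field].
  - subst_derive (hchi t).
    match goal with |- context [sqrt ?u] =>
      replace (sqrt u) with (speed mu K (chi t)) by (unfold speed, speed2; f_equal; simpl; field) end.
    field; lra. }
assert (hc : is_derive chi t (D t)) by apply hchi.
change (speed mu K (chi t)) with (D t) in hs.
change oS with (fun t => mu * cos (chi t) * D t); clearbody D.
auto_derive; [repeat split; eexists; first [exact hD | exact hc]|].
subst_derive hc; subst_derive hD.
transitivity (- mu * sin (chi t) * D t ^ 2 + mu * cos (chi t) *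
   (K * mu * cos (chi t) / 2 + K ^ 2 * mu ^ 2 / 4 * cos (chi t) * sin (chi t))); [ring|].
rewrite hs; unfold speed2, okap, oP, moment; field.
Qed.

Lemma opsi_derive (t : R) : is_derive opsi t (oP t / ow t).
Proof.
assert (hp := speed_pos mu K (chi t) hmu1 hK0 hKm).
assert (hw := ow_bounds t).
assert (h := is_derive_polar mu K (chi t) hmu1 hK0 hKm).
unfold opsi; auto_derive; [repeat split; eexists; eauto|].
subst_derive (hchi t); subst_derive h; unfold rate, oP, ow in *; field; lra.
Qed.

Lemma oX_derive (t : R) : is_derive oX t (oU t).
Proof.
assert (hw := ow_bounds t).
assert (hq : 0 < sqrt (ow t)) by (apply sqrt_lt_R0; lra).
assert (hqq : sqrt (ow t) * sqrt (ow t) = ow t) by (apply sqrt_sqrt; lra).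
unfold oX at 1; auto_derive.
- repeat split; try lra; first [ex_derive_by (ow_derive t)|ex_derive_by (opsi_derive t)].
- subst_derive (ow_derive t); subst_derive (opsi_derive t).
  unfold oU, oX, oY.
  transitivity (oS t * cos (opsi t) * / sqrt (ow t) - sqrt (ow t) * sin (opsi t) * (oP t / ow t)); [field; lra|].
  replace (/ sqrt (ow t)) with (sqrt (ow t) / ow t); [field; lra|].
  rewrite <- hqq at 2; field; lra.
Qed.

Lemma oY_derive (t : R) : is_derive oY t (oV t).
Proof.
assert (hw := ow_bounds t).
assert (hq : 0 < sqrt (ow t)) by (apply sqrt_lt_R0; lra).
assert (hqq : sqrt (ow t) * sqrt (ow t) = ow t) by (apply sqrt_sqrt; lra).
unfold oY at 1; auto_derive.
- repeat split; try lra; first [ex_derive_by (ow_derive t)|ex_derive_by (opsi_derive t)].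
- subst_derive (ow_derive t); subst_derive (opsi_derive t).
  unfold oV, oX, oY.
  transitivity (oS t * sin (opsi t) * / sqrt (ow t) + sqrt (ow t) * cos (opsi t) * (oP t / ow t)); [field; lra|].
  replace (/ sqrt (ow t)) with (sqrt (ow t) / ow t); [field; lra|].
  rewrite <- hqq at 2; field; lra.
Qed.

Lemma oXY_norm t : oX t ^ 2 + oY t ^ 2 = ow t.
Proof.
unfold oX, oY; rewrite !Rpow_mult_distr, pow2_sqrt by (assert (h := ow_bounds t); lra).
assert (h := sin2_cos2_pow (opsi t)).
transitivity (ow t * (sin (opsi t) ^ 2 + cos (opsi t) ^ 2)); [ring|rewrite h; ring].
Qed.

Lemma oUV_norm t : oU t ^ 2 + oV t ^ 2 = 1.
Proof.
assert (hw := ow_bounds t); assert (h := oXY_norm t); assert (h' := oSP t).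
transitivity ((oS t ^ 2 + oP t ^ 2) * (oX t ^ 2 + oY t ^ 2) / ow t ^ 2).
- unfold oU, oV; field; lra.
- rewrite h, h'; field; lra.
Qed.

Lemma oXU_dot t : oX t * oU t + oY t * oV t = oS t.
Proof.
assert (hw := ow_bounds t); assert (h := oXY_norm t).
transitivity (oS t * (oX t ^ 2 + oY t ^ 2) / ow t); [unfold oU, oV; field; lra|].
rewrite h; field; lra.
Qed.

Lemma oXU_cross t : oX t * oV t - oY t * oU t = oP t.
Proof.
assert (hw := ow_bounds t); assert (h := oXY_norm t).
transitivity (oP t * (oX t ^ 2 + oY t ^ 2) / ow t); [unfold oU, oV; field; lra|].
rewrite h; field; lra.
Qed.

Lemma oU_derive (t : R) : is_derive oU t (- okap t * oV t).
Proof.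
assert (hw := ow_bounds t); assert (h := oSP t).
unfold oU at 1; auto_derive.
- repeat split; try lra; first [ex_derive_by (ow_derive t)|ex_derive_by (oS_derive t)
   |ex_derive_by (oP_derive t)|ex_derive_by (oX_derive t)|ex_derive_by (oY_derive t)].
- subst_derive (ow_derive t); subst_derive (oS_derive t); subst_derive (oP_derive t).
  subst_derive (oX_derive t); subst_derive (oY_derive t).
  unfold oU, oV.
  replace (oP t * oP t) with (ow t - oS t ^ 2) by lra.
  transitivity (((1 - okap t * oP t) * oX t * ow t + (oS t ^ 2 - oP t ^ 2 - 2 * oS t ^ 2) * oX t
     - okap t * oS t * oY t * ow t) / ow t ^ 2); [field; lra|].
  replace (oS t ^ 2 - oP t ^ 2 - 2 * oS t ^ 2) with (- ow t) by lra.
  field; lra.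
Qed.

Lemma oV_derive (t : R) : is_derive oV t (okap t * oU t).
Proof.
assert (hw := ow_bounds t); assert (h := oSP t).
unfold oV at 1; auto_derive.
- repeat split; try lra; first [ex_derive_by (ow_derive t)|ex_derive_by (oS_derive t)
   |ex_derive_by (oP_derive t)|ex_derive_by (oX_derive t)|ex_derive_by (oY_derive t)].
- subst_derive (ow_derive t); subst_derive (oS_derive t); subst_derive (oP_derive t).
  subst_derive (oX_derive t); subst_derive (oY_derive t).
  unfold oU, oV.
  transitivity (((1 - okap t * oP t) * oY t * ow t + (oS t ^ 2 - oP t ^ 2 - 2 * oS t ^ 2) * oY t
     + okap t * oS t * oX t * ow t) / ow t ^ 2); [field; lra|].
  replace (oS t ^ 2 - oP t ^ 2 - 2 * oS t ^ 2) with (- ow t) by lra.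
  field; lra.
Qed.

End Oval.

(** * Tangent chords *)

Section Chord.
Variables (K mu l : R) (w P S kap x y u v : R -> R).
Hypothesis hK : 15 <= K.
Hypothesis hl : 0 < l <= 1 / 4.
Hypothesis hP : forall t, 99 / 100 <= P t <= 101 / 100.
Hypothesis hS : forall t, - (1 / 50) <= S t <= 1 / 50.
Hypothesis hkap : forall t, 15 / 16 <= kap t <= 17 / 16.
Hypothesis hkapw : forall t, kap t = 1 + K / 2 * (w t - 1 - mu ^ 2).
Hypothesis dP : forall t : R, is_derive P t (kap t * S t).
Hypothesis dS : forall t : R, is_derive S t (1 - kap t * P t).
Hypothesis dkap : forall t : R, is_derive kap t (K * S t).
Hypothesis dx : forall t : R, is_derive x t (u t).
Hypothesis dy : forall t : R, is_derive y t (v t).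
Hypothesis du : forall t : R, is_derive u t (- kap t * v t).
Hypothesis dv : forall t : R, is_derive v t (kap t * u t).
Hypothesis hxy : forall t, x t ^ 2 + y t ^ 2 = w t.
Hypothesis huv : forall t, u t ^ 2 + v t ^ 2 = 1.
Hypothesis hdot : forall t, x t * u t + y t * v t = S t.
Hypothesis hcross : forall t, x t * v t - y t * u t = P t.

(** Coefficients of the condition that the front end turn at the rate its field prescribes. The
    front turns at [2 * csin / l - kap], and the two fields differ by [K / 2] times the difference
    of the squared radii, which is affine in the sine and cosine of the chord angle. *)
Definition cE t := 1 + K * l ^ 2 * P t.
Definition cF t := K * l ^ 2 * S t.
Definition cG t := l * (kap t + K * l ^ 2).
Definition cdisc t := cE t ^ 2 + cF t ^ 2 - cG t ^ 2.
(* [ccos] and [csin] are the cosine and sine of the angle between the velocity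
   of the rear end of the chord and the chord: the root with positive cosine of
   [cE * sin - cF * cos = cG]. *)
Definition ccos t := (cE t * sqrt (cdisc t) - cF t * cG t) / (cE t ^ 2 + cF t ^ 2).
Definition csin t := (cE t * cG t + cF t * sqrt (cdisc t)) / (cE t ^ 2 + cF t ^ 2).

Lemma cG_pos t : 0 < cG t.
Proof. unfold cG; specialize (hkap t); apply Rmult_lt_0_compat; nra. Qed.

(** Termwise, from [l <= 1 / 4]: [l * kap < 1], and [l * (K * l ^ 2)] is below [K * l ^ 2 * P]. *)
Lemma cG_lt_cE t : cG t < cE t.
Proof.
unfold cG, cE; specialize (hkap t); specialize (hP t).
assert (0 <= K * l ^ 2) by nra.
assert (l * kap t <= 1 / 4 * (17 / 16)) by (apply Rmult_le_compat; lra).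
assert (l * (K * l ^ 2) <= 1 / 4 * (K * l ^ 2)) by (apply Rmult_le_compat_r; lra).
nra.
Qed.

Lemma cdisc_pos t : 0 < cdisc t.
Proof.
assert (h1 := cG_pos t); assert (h2 := cG_lt_cE t); unfold cdisc.
assert (0 <= cF t ^ 2) by apply pow2_ge_0. nra.
Qed.

Lemma cnorm_pos t : 0 < cE t ^ 2 + cF t ^ 2.
Proof.
assert (h1 := cG_pos t); assert (h2 := cG_lt_cE t).
assert (0 <= cF t ^ 2) by apply pow2_ge_0. nra.
Qed.

Lemma cdisc_sqrt t : sqrt (cdisc t) ^ 2 = cdisc t.
Proof. apply pow2_sqrt; left; apply cdisc_pos. Qed.

Lemma chord_constraint t : cE t * csin t - cF t * ccos t = cG t.
Proof. assert (h := cnorm_pos t); unfold ccos, csin; field; lra. Qed.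

Lemma chord_transversal t : cE t * ccos t + cF t * csin t = sqrt (cdisc t).
Proof. assert (h := cnorm_pos t); unfold ccos, csin; field; lra. Qed.

Lemma chord_norm t : csin t ^ 2 + ccos t ^ 2 = 1.
Proof.
assert (h := cnorm_pos t).
transitivity ((cG t ^ 2 + sqrt (cdisc t) ^ 2) / (cE t ^ 2 + cF t ^ 2)); [unfold ccos, csin; field; lra|].
rewrite cdisc_sqrt; unfold cdisc; field; lra.
Qed.

Lemma ccos_pos t : 0 < ccos t.
Proof.
assert (h := cnorm_pos t); assert (h1 := cG_pos t); assert (h2 := cG_lt_cE t).
assert (h3 := cdisc_sqrt t); assert (h4 := sqrt_lt_R0 _ (cdisc_pos t)).
apply Rdiv_lt_0_compat; trivial.
(* Otherwise squaring would give [(cE ^ 2 + cF ^ 2) * (cE ^ 2 - cG ^ 2) <= 0]. *)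
apply Rnot_le_lt; intros h5.
assert (h6 : (cE t * sqrt (cdisc t)) ^ 2 <= (cF t * cG t) ^ 2).
{ apply pow_incr; split; [apply Rmult_le_pos|]; lra. }
rewrite !Rpow_mult_distr, h3 in h6; unfold cdisc in h6.
assert (0 < (cE t ^ 2 + cF t ^ 2) * (cE t ^ 2 - cG t ^ 2)); [|lra].
apply Rmult_lt_0_compat; [trivial|nra].
Qed.

(* Differentiating the relations [csin^2 + ccos^2 = 1] and [chord_constraint]
   gives a linear system for the two derivatives with determinant
   [sqrt cdisc]; the announced values solve it. *)
Lemma chord_derive (t : R) :
  is_derive ccos t (- csin t * (csin t / l - kap t)) /\
  is_derive csin t (ccos t * (csin t / l - kap t)).
Proof.
assert (hn := cnorm_pos t); assert (hd := cdisc_pos t); assert (hq := sqrt_lt_R0 _ hd).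
assert (dE : is_derive cE t (K * l ^ 2 * (kap t * S t))).
{ unfold cE; auto_derive; [repeat split; ex_derive_by (dP t)|].
  subst_derive (dP t); ring. }
assert (dF : is_derive cF t (K * l ^ 2 * (1 - kap t * P t))).
{ unfold cF; auto_derive; [repeat split; ex_derive_by (dS t)|].
  subst_derive (dS t); ring. }
assert (dG : is_derive cG t (l * (K * S t))).
{ unfold cG; auto_derive; [repeat split; ex_derive_by (dkap t)|].
  subst_derive (dkap t); ring. }
assert (dD : ex_derive cdisc t).
{ unfold cdisc; auto_derive; repeat split;
  first [ex_derive_by dE | ex_derive_by dF | ex_derive_by dG]. }
assert (ec : ex_derive ccos t).
{ destruct dD as [dd dD]; unfold ccos; auto_derive; repeat split; trivial;
  try first [ex_derive_by dE | ex_derive_by dF | ex_derive_by dG | ex_derive_by dD].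
  simpl in hn; lra. }
assert (es : ex_derive csin t).
{ destruct dD as [dd dD]; unfold csin; auto_derive; repeat split; trivial;
  try first [ex_derive_by dE | ex_derive_by dF | ex_derive_by dG | ex_derive_by dD].
  simpl in hn; lra. }
destruct ec as [c' ec]; destruct es as [s' es].
assert (e1 : csin t * s' + ccos t * c' = 0).
{ assert (h1 : is_derive (fun r => csin r ^ 2 + ccos r ^ 2) t (2 * (csin t * s' + ccos t * c'))).
  { auto_derive; [repeat split; first [ex_derive_by es | ex_derive_by ec]|].
    subst_derive es; subst_derive ec; ring. }
  assert (h2 : is_derive (fun r => csin r ^ 2 + ccos r ^ 2) t 0).
  { apply (is_derive_ext (fun _ => 1)); [intros r; now rewrite chord_norm|].
    apply (is_derive_const (V := R_NormedModule)). }
  assert (h3 := is_derive_unique _ _ _ h1); rewrite (is_derive_unique _ _ _ h2) in h3; lra. }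
assert (e2 : K * l ^ 2 * (kap t * S t) * csin t + cE t * s'
   - K * l ^ 2 * (1 - kap t * P t) * ccos t - cF t * c' = l * (K * S t)).
{ assert (h1 : is_derive (fun r => cE r * csin r - cF r * ccos r) t
     (K * l ^ 2 * (kap t * S t) * csin t + cE t * s'
   - K * l ^ 2 * (1 - kap t * P t) * ccos t - cF t * c')).
  { auto_derive; [repeat split; first [ex_derive_by es | ex_derive_by ec | ex_derive_by dE | ex_derive_by dF]|].
    subst_derive es; subst_derive ec; subst_derive dE; subst_derive dF; ring. }
  assert (h2 : is_derive (fun r => cE r * csin r - cF r * ccos r) t (l * (K * S t))).
  { apply (is_derive_ext cG); [intros r; now rewrite chord_constraint|exact dG]. }
  rewrite <- (is_derive_unique _ _ _ h1); exact (is_derive_unique _ _ _ h2). }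
set (b := csin t / l - kap t).
(* The constraint is preserved by the motion of the chord: inserting it for [cG] leaves
   [cF * (csin ^ 2 + ccos ^ 2)], which is [l] times the right-hand side. *)
assert (e3 : K * l ^ 2 * (kap t * S t) * csin t + cE t * (ccos t * b)
   - K * l ^ 2 * (1 - kap t * P t) * ccos t - cF t * (- csin t * b) = l * (K * S t)).
{ assert (h := chord_constraint t); assert (hn1 := chord_norm t).
  apply Rmult_eq_reg_l with l; [|lra].
  transitivity (csin t * (cE t * ccos t + cF t * csin t) - ccos t * cG t).
  - unfold b, cE, cF, cG; field; lra.
  - rewrite <- h; transitivity (cF t * (csin t ^ 2 + ccos t ^ 2)); [ring|].
    rewrite hn1; unfold cF; ring. }
assert (htr := chord_transversal t); assert (hn1 := chord_norm t).
set (ds := s' - ccos t * b) in *; set (dc := c' + csin t * b) in *.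
assert (f1 : csin t * ds + ccos t * dc = 0) by (unfold ds, dc; lra).
assert (f2 : cE t * ds - cF t * dc = 0) by (unfold ds, dc; lra).
assert (f3 : sqrt (cdisc t) * ds = 0).
{ rewrite <- htr.
  transitivity (ccos t * (cE t * ds - cF t * dc) + cF t * (csin t * ds + ccos t * dc)); [ring|].
  rewrite f1, f2; ring. }
assert (f4 : sqrt (cdisc t) * dc = 0).
{ rewrite <- htr.
  transitivity (cE t * (csin t * ds + ccos t * dc) - csin t * (cE t * ds - cF t * dc)); [ring|].
  rewrite f1, f2; ring. }
assert (g1 : ds = 0) by (apply Rmult_integral in f3; destruct f3; lra).
assert (g2 : dc = 0) by (apply Rmult_integral in f4; destruct f4; lra).
replace (- csin t * b) with c' by (unfold dc in g2; lra).
replace (ccos t * b) with s' by (unfold ds in g1; lra).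
split; assumption.
Qed.

(** Unit direction of the chord: the rear velocity turned counterclockwise by the chord angle. *)
Definition de1 t := ccos t * u t - csin t * v t.
Definition de2 t := ccos t * v t + csin t * u t.

Lemma de_norm t : de1 t ^ 2 + de2 t ^ 2 = 1.
Proof.
transitivity ((csin t ^ 2 + ccos t ^ 2) * (u t ^ 2 + v t ^ 2)); [unfold de1, de2; ring|].
rewrite chord_norm, huv; ring.
Qed.

Lemma u_of_de t : u t = ccos t * de1 t + csin t * de2 t.
Proof.
transitivity ((csin t ^ 2 + ccos t ^ 2) * u t); [rewrite chord_norm; ring|unfold de1, de2; ring].
Qed.

Lemma v_of_de t : v t = ccos t * de2 t - csin t * de1 t.
Proof.
transitivity ((csin t ^ 2 + ccos t ^ 2) * v t); [rewrite chord_norm; ring|unfold de1, de2; ring].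
Qed.

(** The field turns the velocity at rate [kap] and the chord angle grows at rate [csin / l - kap].
    The sum [csin / l] is the rate for which the midpoint has no velocity across the chord. *)
Lemma de_derive (t : R) :
  is_derive de1 t (- (csin t / l) * de2 t) /\ is_derive de2 t (csin t / l * de1 t).
Proof.
destruct (chord_derive t) as [dc ds].
split.
- unfold de1 at 1; auto_derive; [repeat split; first [ex_derive_by dc|ex_derive_by ds|ex_derive_by (du t)|ex_derive_by (dv t)]|].
  subst_derive dc; subst_derive ds; subst_derive (du t); subst_derive (dv t).
  unfold de2; ring.
- unfold de2 at 1; auto_derive; [repeat split; first [ex_derive_by dc|ex_derive_by ds|ex_derive_by (du t)|ex_derive_by (dv t)]|].
  subst_derive dc; subst_derive ds; subst_derive (du t); subst_derive (dv t).
  unfold de1; ring.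
Qed.

Definition mid1 t := x t + l * de1 t.
Definition mid2 t := y t + l * de2 t.

Lemma mid_derive (t : R) :
  is_derive mid1 t (ccos t * de1 t) /\ is_derive mid2 t (ccos t * de2 t).
Proof.
destruct (de_derive t) as [d1 d2]; split.
- unfold mid1; auto_derive; [repeat split; first [ex_derive_by d1|ex_derive_by (dx t)]|].
  subst_derive d1; subst_derive (dx t); rewrite u_of_de; field; lra.
- unfold mid2; auto_derive; [repeat split; first [ex_derive_by d2|ex_derive_by (dy t)]|].
  subst_derive d2; subst_derive (dy t); rewrite v_of_de; field; lra.
Qed.

Lemma mid_dot t : mid1 t * de1 t + mid2 t * de2 t = ccos t * S t - csin t * P t + l.
Proof.
transitivity (ccos t * (x t * u t + y t * v t) - csin t * (x t * v t - y t * u t)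
  + l * (de1 t ^ 2 + de2 t ^ 2)); [unfold mid1, mid2, de1, de2; ring|].
rewrite hdot, hcross, de_norm; ring.
Qed.

Lemma mid_cross t : mid1 t * de2 t - mid2 t * de1 t = ccos t * P t + csin t * S t.
Proof. rewrite <- hdot, <- hcross; unfold mid1, mid2, de1, de2; ring. Qed.

Definition front1 t := x t + 2 * l * de1 t.
Definition front2 t := y t + 2 * l * de2 t.
(** Mirror image of the rear velocity in the chord. *)
Definition fvel1 t := ccos t * de1 t - csin t * de2 t.
Definition fvel2 t := ccos t * de2 t + csin t * de1 t.

Lemma fvel_norm t : fvel1 t ^ 2 + fvel2 t ^ 2 = 1.
Proof.
transitivity ((csin t ^ 2 + ccos t ^ 2) * (de1 t ^ 2 + de2 t ^ 2)); [unfold fvel1, fvel2; ring|].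
rewrite chord_norm, de_norm; ring.
Qed.

Lemma front_derive (t : R) : is_derive front1 t (fvel1 t) /\ is_derive front2 t (fvel2 t).
Proof.
destruct (de_derive t) as [d1 d2]; split.
- unfold front1; auto_derive; [repeat split; first [ex_derive_by d1|ex_derive_by (dx t)]|].
  subst_derive d1; subst_derive (dx t); rewrite u_of_de; unfold fvel1; field; lra.
- unfold front2; auto_derive; [repeat split; first [ex_derive_by d2|ex_derive_by (dy t)]|].
  subst_derive d2; subst_derive (dy t); rewrite v_of_de; unfold fvel2; field; lra.
Qed.

Lemma front_norm t :
  front1 t ^ 2 + front2 t ^ 2 = w t + 4 * l ^ 2 + 4 * l * (ccos t * S t - csin t * P t).
Proof.
transitivity (x t ^ 2 + y t ^ 2 + 4 * l * (ccos t * (x t * u t + y t * v t)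
  - csin t * (x t * v t - y t * u t)) + 4 * l ^ 2 * (de1 t ^ 2 + de2 t ^ 2));
  [unfold front1, front2, de1, de2; ring|].
rewrite hdot, hcross, de_norm, hxy; ring.
Qed.

(** The left side is the rate at which the front velocity turns: the rate of the chord plus that of
    the chord angle. *)
Lemma turning_rate t :
  2 * (csin t / l) - kap t = 1 + K / 2 * (front1 t ^ 2 + front2 t ^ 2 - 1 - mu ^ 2).
Proof.
assert (h := chord_constraint t); unfold cE, cF, cG in h.
assert (e : csin t / l = kap t + K * l ^ 2 + K * l * (ccos t * S t - csin t * P t)).
{ apply Rmult_eq_reg_l with l; [|lra].
  transitivity (csin t); [field; lra|lra]. }
rewrite e, front_norm; assert (h1 := hkapw t); lra.
Qed.

(* Both ends of the chord obey the same law of motion. *)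
Lemma fvel_derive (t : R) :
  is_derive fvel1 t (- (1 - K / 2 * (1 + mu ^ 2) + K / 2 * (front1 t ^ 2 + front2 t ^ 2)) * fvel2 t) /\
  is_derive fvel2 t ((1 - K / 2 * (1 + mu ^ 2) + K / 2 * (front1 t ^ 2 + front2 t ^ 2)) * fvel1 t).
Proof.
replace (1 - K / 2 * (1 + mu ^ 2) + K / 2 * (front1 t ^ 2 + front2 t ^ 2))
  with (2 * (csin t / l) - kap t) by (rewrite turning_rate; ring).
destruct (chord_derive t) as [dc ds]; destruct (de_derive t) as [d1 d2]; split.
- unfold fvel1 at 1; auto_derive; [repeat split; first [ex_derive_by dc|ex_derive_by ds|ex_derive_by d1|ex_derive_by d2]|].
  subst_derive dc; subst_derive ds; subst_derive d1; subst_derive d2.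
  unfold fvel2; ring.
- unfold fvel2 at 1; auto_derive; [repeat split; first [ex_derive_by dc|ex_derive_by ds|ex_derive_by d1|ex_derive_by d2]|].
  subst_derive dc; subst_derive ds; subst_derive d1; subst_derive d2.
  unfold fvel1; ring.
Qed.

Lemma front_follows (T : R) :
  (forall t, w t <= 2) ->
  front1 0 = x T -> front2 0 = y T -> fvel1 0 = u T -> fvel2 0 = v T ->
  forall t, front1 t = x (t + T) /\ front2 t = y (t + T).
Proof.
intros hw i1 i2 i3 i4.
(* 7 is a generous bound on both squared radii; the front one is at most [2 + 1 / 4 + 103 / 100]. *)
apply (magnetic_unique (1 - K / 2 * (1 + mu ^ 2)) (K / 2) 7
  front1 front2 fvel1 fvel2 (fun t => x (t + T)) (fun t => y (t + T))
  (fun t => u (t + T)) (fun t => v (t + T))); try lra.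
- intros t; apply front_derive.
- intros t; apply front_derive.
- intros t; apply fvel_derive.
- intros t; apply fvel_derive.
- intros t; auto_derive; [repeat split; ex_derive_by (dx (t + T))|subst_derive (dx (t + T)); ring].
- intros t; auto_derive; [repeat split; ex_derive_by (dy (t + T))|subst_derive (dy (t + T)); ring].
- intros t; auto_derive; [repeat split; ex_derive_by (du (t + T))|subst_derive (du (t + T))].
  rewrite hkapw, <- hxy; field.
- intros t; auto_derive; [repeat split; ex_derive_by (dv (t + T))|subst_derive (dv (t + T))].
  rewrite hkapw, <- hxy; field.
- intros t; apply huv.
- intros t; rewrite front_norm.
  assert (hn := chord_norm t); specialize (hS t); specialize (hP t); specialize (hw t).
  assert (- 1 <= csin t <= 1) by (split; nra).
  assert (- 1 <= ccos t <= 1) by (split; nra).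
  assert (ccos t * S t - csin t * P t <= 103 / 100) by nra.
  assert (l * (ccos t * S t - csin t * P t) <= 1 / 4 * (103 / 100)) by nra.
  nra.
- intros t; rewrite hxy; specialize (hw (t + T)); lra.
- rewrite Rplus_0_l; exact i1.
- rewrite Rplus_0_l; exact i2.
- rewrite Rplus_0_l; exact i3.
- rewrite Rplus_0_l; exact i4.
Qed.

End Chord.

(** * Matching the two ends of the chord *)

Lemma atan_le (z : R) : 0 <= z -> atan z <= z.
Proof.
intros hz; assert (h : 0 - atan 0 <= z - atan z); [|rewrite atan_0 in h; lra].
apply (derive_nonneg_le (fun x => x - atan x) (fun x => 1 - / (1 + x²))); trivial.
- intros x _; auto_derive; [trivial|unfold Rsqr; field; nra].
- intros x _; assert (0 <= x²) by apply Rle_0_sqr.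
  assert (/ (1 + x²) <= / 1) by (apply Rinv_le_contravar; lra). lra.
Qed.

Lemma div_sqrt_le_atan (z : R) : 0 < z -> z / sqrt (1 + z²) < atan z.
Proof.
intros hz; rewrite <- sin_atan; apply sin_lt_x.
rewrite <- atan_0; now apply atan_increasing.
Qed.

Lemma polar_incr (mu K a b : R) : 0 < mu < 1 / 2 -> 0 <= K -> K * mu <= 1 / 8 ->
  a <= b -> polar mu K a <= polar mu K b.
Proof.
intros h0 hK hm hab; assert (h : 0 < mu < 1) by lra.
apply (derive_nonneg_le (polar mu K) (rate mu K)); trivial.
- intros x _; now apply is_derive_polar.
- intros x _; assert (h1 := rad2_bounds mu x h); assert (h2 := speed_pos mu K x h hK hm).
  assert (h3 := moment_bounds mu K x h hK hm).
  assert (K * mu * mu <= 1 / 8 * mu) by (apply Rmult_le_compat_r; lra).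
  left; apply Rdiv_lt_0_compat; [lra|apply Rmult_lt_0_compat; nra].
Qed.

Section Matching.
Variables (mu K : R).
Hypothesis hmu : 0 < mu <= 1 / 240.
Hypothesis hK : 15 <= K.
Hypothesis hKmu : K * mu <= 1 / 16.

(* Sine and cosine of the chord angle when the rear end is at a pericentre,
   and sine of the phase [chi] reached by the front end. *)
Definition aden l := 1 + K * l ^ 2 * (1 - mu).
Definition asn l := l * (1 - K * mu + K * l ^ 2) / aden l.
Definition acs l := sqrt (1 - asn l ^ 2).
Definition aphase l := - 1 + 2 * l ^ 2 * (1 + K * (1 - mu)) / aden l.
(** Front end for the rear end at the pericentre [(1 - mu, 0)] with velocity [(0, 1)]. *)
Definition afr1 l := 1 - mu - 2 * l * asn l.
Definition afr2 l := 2 * l * acs l.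

Lemma aden_pos l : 1 <= aden l.
Proof. unfold aden; assert (0 <= K * l ^ 2) by nra; nra. Qed.

Lemma asn_bounds l : 0 < l <= 1 / 4 -> 0 < asn l <= 27 / 100.
Proof.
intros hl; assert (hd := aden_pos l).
assert (hk : 0 <= K * mu) by nra.
assert (hkl : 0 <= K * l ^ 2) by nra.
split.
- apply Rdiv_lt_0_compat; [apply Rmult_lt_0_compat|]; lra.
- apply Rmult_le_reg_r with (aden l); [lra|].
  replace (asn l * aden l) with (l * (1 - K * mu + K * l ^ 2)) by (unfold asn; field; lra).
  apply Rle_trans with (1 / 4 * (1 + K * l ^ 2)); [apply Rmult_le_compat; lra|].
  unfold aden; nra.
Qed.

Lemma acs_bounds l : 0 < l <= 1 / 4 -> 95 / 100 <= acs l <= 1.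
Proof.
intros hl; destruct (asn_bounds l hl); unfold acs; split.
- rewrite <- (sqrt_pow2 (95 / 100)) by lra; apply sqrt_le_1_alt; nra.
- apply Rle_trans with (sqrt 1); [apply sqrt_le_1_alt; nra|rewrite sqrt_1; lra].
Qed.

Lemma acs_sq l : 0 < l <= 1 / 4 -> acs l ^ 2 = 1 - asn l ^ 2.
Proof. intros hl; destruct (asn_bounds l hl); unfold acs; apply pow2_sqrt; nra. Qed.

(** Strictness is used twice: [asin] is differentiable there, and the front end is not at an
    apocentre, which makes the track non-circular. *)
Lemma aphase_bounds l : 0 < l <= 1 / 4 -> - 1 < aphase l < 1.
Proof.
intros hl; assert (hd := aden_pos l); unfold aphase; split.
- assert (0 < 2 * l ^ 2 * (1 + K * (1 - mu)) / aden l); [|lra].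
  apply Rdiv_lt_0_compat; [|lra]; repeat apply Rmult_lt_0_compat; nra.
- assert (e : 1 - (- 1 + 2 * l ^ 2 * (1 + K * (1 - mu)) / aden l) = 2 * (1 - l ^ 2) / aden l)
    by (unfold aden in *; field; lra).
  assert (0 < 2 * (1 - l ^ 2) / aden l) by (apply Rdiv_lt_0_compat; nra).
  lra.
Qed.

Lemma afr1_pos l : 0 < l <= 1 / 4 -> 85 / 100 <= afr1 l.
Proof. intros hl; destruct (asn_bounds l hl); unfold afr1; nra. Qed.

(** This equation determines [aphase]; solving it, [l - (1 - mu) * asn l] turns out divisible by
    [mu], so the closed form has no [mu] in its denominator. *)
Lemma afr_norm l : 0 < l <= 1 / 4 -> afr1 l ^ 2 + afr2 l ^ 2 = 1 + mu ^ 2 + 2 * mu * aphase l.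
Proof.
intros hl; assert (hd := aden_pos l); unfold afr1, afr2.
transitivity ((1 - mu) ^ 2 - 4 * l * (1 - mu) * asn l + 4 * l ^ 2 * asn l ^ 2 + 4 * l ^ 2 * acs l ^ 2); [ring|].
rewrite acs_sq by trivial; unfold asn, aphase, aden in *; field; lra.
Qed.

(** The angle on the left is about [2 * l], while the right side lies between [2 * PI / n] and
    [4 * PI / n]. The left side is at most [5 / 2 * / n] for [l = 1 / n] and at least [16 * / n] for
    [l = 10 / n]; [n >= 40] keeps [10 / n] below 1/4. *)
Lemma exists_matching (n : R) : 40 <= n -> polar mu K (3 * PI / 2) = 2 * PI / n ->
  exists l, 1 / n <= l <= 10 / n /\
    atan (afr2 l / afr1 l) = polar mu K (asin (aphase l)) + 2 * PI / n.
Proof.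
intros hn hp.
assert (hPI := PI2_3_2); assert (hPI4 := PI_4).
assert (hn1 : 0 < / n <= 1 / 40).
{ split; [apply Rinv_0_lt_compat; lra|]; replace (1 / 40) with (/ 40) by field; apply Rinv_le_contravar; lra. }
assert (hrange : forall l, 1 / n <= l <= 10 / n -> 0 < l <= 1 / 4) by (intros l hl; unfold Rdiv in hl; lra).
assert (has : forall l, 0 < l <= 1 / 4 -> polar mu K (asin (aphase l)) <= 2 * PI / n /\
  0 <= polar mu K (asin (aphase l))).
{ intros l hl; destruct (asin_bound (aphase l)); split.
  - rewrite <- hp; apply polar_incr; lra.
  - replace 0 with (polar mu K (- PI / 2)) by (unfold polar; now rewrite RInt_point).
    apply polar_incr; lra. }
destruct (IVT_interv (fun l => atan (afr2 l / afr1 l) - polar mu K (asin (aphase l)) - 2 * PI / n)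
  (1 / n) (10 / n)) as [l [hl e]].
- intros l hl'; assert (hl := hrange l hl'); clear hl'.
  assert (h1 := afr1_pos l hl); assert (h2 := aden_pos l); assert (h3 := aphase_bounds l hl).
  destruct (acs_bounds l hl) as [h4 _]; destruct (asn_bounds l hl) as [h5 h6].
  assert (dn : ex_derive asn l) by (unfold asn, aden in *; auto_derive; simpl in h2; lra).
  assert (dc : ex_derive acs l).
  { unfold acs; auto_derive; repeat split; trivial. simpl; nra. }
  assert (dp : ex_derive aphase l) by (unfold aphase, aden in *; auto_derive; simpl in h2; lra).
  assert (d1 : ex_derive afr1 l) by (unfold afr1; auto_derive; trivial).
  assert (d2 : ex_derive afr2 l) by (unfold afr2; auto_derive; trivial).
  apply continuity_pt_minus; [|apply continuity_pt_const; now intros ? ?].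
  apply continuity_pt_minus.
  + assert (da : ex_derive (fun l => atan (afr2 l / afr1 l)) l)
      by (auto_derive; repeat split; trivial; lra).
    destruct da as [a' da]; exact (is_derive_continuity_pt _ _ _ da).
  + apply (continuity_pt_comp (fun l => asin (aphase l)) (polar mu K)).
    * apply (continuity_pt_comp aphase asin).
      -- destruct dp as [a' dp]; exact (is_derive_continuity_pt _ _ _ dp).
      -- apply derivable_continuous_pt, derivable_pt_asin; lra.
    * eapply is_derive_continuity_pt; apply is_derive_polar; lra.
- unfold Rdiv; lra.
- assert (hl : 0 < 1 / n <= 1 / 4) by (unfold Rdiv; lra).
  destruct (has _ hl) as [_ h1]; assert (h2 := acs_bounds _ hl).
  assert (h3 := afr1_pos _ hl).
  assert (hz : afr2 (1 / n) / afr1 (1 / n) <= 5 / 2 * / n).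
  { apply Rmult_le_reg_r with (afr1 (1 / n)); [lra|].
    replace (afr2 (1 / n) / afr1 (1 / n) * afr1 (1 / n)) with (afr2 (1 / n)) by (field; lra).
    unfold afr2, Rdiv; nra. }
  assert (hz0 : 0 <= afr2 (1 / n) / afr1 (1 / n)).
  { apply Rmult_le_pos; [unfold afr2; nra|left; apply Rinv_0_lt_compat; lra]. }
  assert (h4 := atan_le _ hz0).
  assert (5 / 2 * / n < 2 * PI / n) by (unfold Rdiv at 2; apply Rmult_lt_compat_r; lra).
  lra.
- assert (hl : 0 < 10 / n <= 1 / 4) by (unfold Rdiv; lra).
  destruct (has _ hl) as [h1 _]; assert (h2 := acs_bounds _ hl).
  assert (h3 := afr1_pos _ hl); assert (h4 := aphase_bounds _ hl).
  assert (h5 := afr_norm _ hl).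
  assert (h2' : 19 * / n <= afr2 (10 / n)) by (unfold afr2, Rdiv; nra).
  set (a := afr1 (10 / n)) in *; set (b := afr2 (10 / n)) in *.
  assert (hb : 0 < b) by lra.
  assert (hz : 0 < b / a) by (apply Rdiv_lt_0_compat; lra).
  assert (h6 := div_sqrt_le_atan _ hz).
  assert (h7 : 0 < sqrt (a ^ 2 + b ^ 2) <= 101 / 100).
  { split; [apply sqrt_lt_R0; nra|].
    rewrite <- (sqrt_pow2 (101 / 100)) by lra; apply sqrt_le_1_alt; rewrite h5; nra. }
  assert (e : b / a / sqrt (1 + (b / a)²) = b / sqrt (a ^ 2 + b ^ 2)).
  { replace (a ^ 2 + b ^ 2) with (a ^ 2 * (1 + (b / a)²)) by (unfold Rsqr; field; lra).
    assert (0 <= (b / a)²) by apply Rle_0_sqr.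
    rewrite sqrt_mult, sqrt_pow2 by nra.
    assert (0 < sqrt (1 + (b / a)²)) by (apply sqrt_lt_R0; lra).
    field; lra. }
  assert (h8 : 16 * / n <= b / sqrt (a ^ 2 + b ^ 2)).
  { apply Rmult_le_reg_r with (sqrt (a ^ 2 + b ^ 2)); [lra|].
    replace (b / sqrt (a ^ 2 + b ^ 2) * sqrt (a ^ 2 + b ^ 2)) with b by (field; lra). nra. }
  assert (4 * PI / n <= 16 * / n) by (unfold Rdiv; nra).
  unfold Rdiv in *; lra.
- exists l; split; [exact hl|lra].
Qed.

End Matching.

(** * Closed tracks of ambiguous direction *)

Lemma cos_sin_atan_div (a b : R) : 0 < a ->
  cos (atan (b / a)) = a / sqrt (a ^ 2 + b ^ 2) /\ sin (atan (b / a)) = b / sqrt (a ^ 2 + b ^ 2).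
Proof.
intros ha; rewrite cos_atan, sin_atan.
assert (h : 0 <= (b / a)²) by apply Rle_0_sqr.
assert (e : sqrt (a ^ 2 + b ^ 2) = a * sqrt (1 + (b / a)²)).
{ replace (a ^ 2 + b ^ 2) with (a ^ 2 * (1 + (b / a)²)) by (unfold Rsqr; field; lra).
  rewrite sqrt_mult, sqrt_pow2 by nra; reflexivity. }
assert (0 < sqrt (1 + (b / a)²)) by (apply sqrt_lt_R0; lra).
rewrite e; split; field; lra.
Qed.

(* Tangent lines of the curve [m] cut out chords of half-length [l] whose rear
   and front ends run along the same closed curve; [cb] and [sb] are the cosine
   and sine of the angle between chord and end point velocity. *)
Set Implicit Arguments.
Record ambiguous_track (l L tau k : R) (m1 m2 th cb sb : R -> R) : Prop := {
  tr_l : 0 < l <= 1 / 4;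
  tr_L : 0 < L;
  tr_dm1 : forall t : R, is_derive m1 t (cb t * cos (th t));
  tr_dm2 : forall t : R, is_derive m2 t (cb t * sin (th t));
  tr_dth : forall t : R, is_derive th t (sb t / l);
  tr_dcb : forall t : R,
    is_derive cb t (- sb t * (k * (m1 t * cos (th t) + m2 t * sin (th t))));
  tr_dsb : forall t : R,
    is_derive sb t (cb t * (k * (m1 t * cos (th t) + m2 t * sin (th t))));
  tr_m1L : forall t, m1 (t + L) = m1 t;
  tr_m2L : forall t, m2 (t + L) = m2 t;
  tr_thL : forall t, th (t + L) = th t + 2 * PI;
  tr_cbL : forall t, cb (t + L) = cb t;
  tr_sbL : forall t, sb (t + L) = sb t;
  tr_sb : forall t, 15 / 16 <= sb t / l <= 17 / 16;
  tr_cb : forall t, 96 / 100 <= cb t;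
  tr_norm : forall t, sb t ^ 2 + cb t ^ 2 = 1;
  tr_cross : forall t, 94 / 100 <= m1 t * sin (th t) - m2 t * cos (th t);
  tr_dot : forall t, Rabs (m1 t * cos (th t) + m2 t * sin (th t)) <= 1 / 10;
  tr_curv : forall t,
    Rabs (cb t - sb t / l * (m1 t * sin (th t) - m2 t * cos (th t))) <= 1 / 10;
  tr_rear : forall t,
    98 / 100 <= (m1 t - l * cos (th t)) ^ 2 + (m2 t - l * sin (th t)) ^ 2;
  tr_swap1 : forall t,
    m1 t + l * cos (th t) = m1 (t + tau) - l * cos (th (t + tau));
  tr_swap2 : forall t,
    m2 t + l * sin (th t) = m2 (t + tau) - l * sin (th (t + tau));
  tr_nonconst : ~ (forall t t', sb t = sb t')
}.
Unset Implicit Arguments.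

(** * From the matched orbit to a closed track *)

Section Track.
Variables (mu K l T : R) (N : nat) (chi : R -> R).
Hypothesis hmu : 0 < mu <= 1 / 240.
Hypothesis hK : 15 <= K.
Hypothesis hKmu : K * mu <= 1 / 16.
Hypothesis hN : (0 < N)%nat.
Hypothesis hl : 0 < l <= 1 / 4.
Hypothesis hchi : forall t : R, is_derive chi t (speed mu K (chi t)).
Hypothesis hchi0 : chi 0 = - PI / 2.
Hypothesis hT : forall t, chi (t + T) = chi t + 2 * PI.
Hypothesis hsurj : forall a, exists t, chi t = a.
Hypothesis hpolar : forall a, polar mu K (a + 2 * PI) = polar mu K a + 2 * PI / INR N.
Hypothesis hmatch : atan (afr2 mu K l / afr1 mu K l) = polar mu K (asin (aphase mu K l)) + 2 * PI / INR N.

Notation w := (ow mu chi).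
Notation P := (oP mu K chi).
Notation S := (oS mu K chi).
Notation kap := (okap mu K chi).
Notation psi := (opsi mu K chi).
Notation x := (oX mu K chi).
Notation y := (oY mu K chi).
Notation u := (oU mu K chi).
Notation v := (oV mu K chi).
Notation cb := (ccos K l P S kap).
Notation sb := (csin K l P S kap).
Notation e1 := (de1 K l P S kap u v).
Notation e2 := (de2 K l P S kap u v).
Notation m1 := (mid1 K l P S kap x u v).
Notation m2 := (mid2 K l P S kap y u v).
Notation f1 := (front1 K l P S kap x u v).
Notation f2 := (front2 K l P S kap y u v).
Notation h1 := (fvel1 K l P S kap u v).
Notation h2 := (fvel2 K l P S kap u v).

Let bP := oP_bounds mu K chi hmu hK hKmu.
Let bS := oS_bounds mu K chi hmu hK hKmu.
Let bw := ow_bounds mu K chi hmu hK hKmu.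
Let bk := okap_bounds mu K chi hmu hK hKmu.
Let dP := oP_derive mu K chi hchi.
Let dS := oS_derive mu K chi hmu hK hKmu hchi.
Let dk := okap_derive mu K chi hchi.
Let dx := oX_derive mu K chi hmu hK hKmu hchi.
Let dy := oY_derive mu K chi hmu hK hKmu hchi.
Let du := oU_derive mu K chi hmu hK hKmu hchi.
Let dv := oV_derive mu K chi hmu hK hKmu hchi.
Let nxy := oXY_norm mu K chi hmu hK hKmu.
Let nuv := oUV_norm mu K chi hmu hK hKmu.
Let duv := oXU_dot mu K chi hmu hK hKmu.
Let cuv := oXU_cross mu K chi hmu hK hKmu.
Let ek := okapE mu K chi.

(** The front end starts in the state of the orbit at time [T1]: polar angle by [hmatch], radius by
    [afr_norm], velocity because its cross and dot products with the position agree. *)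
Lemma track_front : exists tau,
  sin (chi tau) < 1 /\ forall t, f1 t = x (t + tau) /\ f2 t = y (t + tau).
Proof.
destruct (hsurj (asin (aphase mu K l))) as [t0 ht0].
set (s := aphase mu K l) in *.
assert (hs : - 1 < s < 1) by now apply aphase_bounds.
assert (hss : sin (asin s) = s) by (apply sin_asin; lra).
destruct (asin_bound s) as [ha1 ha2].
assert (hcs : 0 <= cos (asin s)) by (apply cos_ge_0; lra).
assert (hcc := sin2_cos2_pow (asin s)); rewrite hss in hcc.
(* The extra period [T] adds [2 * PI / INR N] to the polar angle, the last term of [hmatch]. *)
assert (hc : chi (t0 + T) = asin s + 2 * PI) by now rewrite hT, ht0.
assert (s0 : sin (chi 0) = - 1).
{ rewrite hchi0; replace (- PI / 2) with (- (PI / 2)) by field; now rewrite sin_neg, sin_PI2. }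
assert (c0 : cos (chi 0) = 0).
{ rewrite hchi0; replace (- PI / 2) with (- (PI / 2)) by field; now rewrite cos_neg, cos_PI2. }
assert (w0 : w 0 = (1 - mu) ^ 2) by (unfold ow, rad2; rewrite s0; ring).
assert (P0 : P 0 = 1 - mu) by (unfold oP, moment; rewrite s0, c0; field).
assert (S0 : S 0 = 0) by (unfold oS; rewrite c0; ring).
assert (k0 : kap 0 = 1 - K * mu) by (unfold okap; rewrite s0; ring).
assert (q0 : psi 0 = 0) by (unfold opsi, polar; rewrite hchi0; now rewrite RInt_point).
assert (r0 : sqrt (w 0) = 1 - mu) by (rewrite w0; apply sqrt_pow2; lra).
assert (x0' : x 0 = 1 - mu) by (unfold oX; rewrite q0, cos_0, r0; ring).
assert (y0' : y 0 = 0) by (unfold oY; rewrite q0, sin_0; ring).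
assert (u0 : u 0 = 0) by (unfold oU; rewrite S0, y0'; field; rewrite w0; nra).
assert (v0 : v 0 = 1) by (unfold oV; rewrite S0, P0, x0', w0; field; lra).
assert (hd := aden_pos mu K hmu hK l).
assert (E0 : cE K l P 0 = aden mu K l) by (unfold cE, aden; rewrite P0; ring).
assert (F0 : cF K l S 0 = 0) by (unfold cF; rewrite S0; ring).
assert (sb0 : sb 0 = asn mu K l).
{ unfold csin; rewrite F0, E0; unfold cG; rewrite k0; unfold asn, aden in *; field; nra. }
assert (cb0 : cb 0 = acs mu K l).
{ assert (hp := ccos_pos K l P S kap hK hl bP bk 0).
  assert (hn := chord_norm K l P S kap hK hl bP bk 0).
  rewrite sb0 in hn; unfold acs; rewrite <- (sqrt_pow2 (cb 0)) by lra; f_equal; lra. }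
assert (hb := acs_bounds mu K hmu hK hKmu l hl).
assert (hbb := acs_sq mu K hmu hK hKmu l hl).
assert (ef1 : f1 0 = afr1 mu K l)
  by (unfold front1, de1, afr1; rewrite x0', u0, v0, sb0, cb0; ring).
assert (ef2 : f2 0 = afr2 mu K l)
  by (unfold front2, de2, afr2; rewrite y0', u0, v0, sb0, cb0; ring).
set (T1 := t0 + T) in *.
assert (sT : sin (chi T1) = s) by (rewrite hc, sin_plus, sin_2PI, cos_2PI, hss; ring).
assert (cT : cos (chi T1) = cos (asin s)) by (rewrite hc, cos_plus, sin_2PI, cos_2PI; ring).
assert (qT : psi T1 = atan (f2 0 / f1 0)).
{ unfold opsi; rewrite hc, hpolar, ef1, ef2, hmatch; reflexivity. }
assert (wT : f1 0 ^ 2 + f2 0 ^ 2 = w T1).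
{ rewrite ef1, ef2, (afr_norm mu K hmu hK hKmu l hl); unfold ow, rad2; rewrite sT; reflexivity. }
assert (hf1 := afr1_pos mu K hmu hK hKmu l hl); rewrite <- ef1 in hf1.
destruct (cos_sin_atan_div (f1 0) (f2 0) ltac:(lra)) as [hca hsa].
rewrite <- qT, wT in hca, hsa.
assert (bw1 := bw T1).
assert (hq : 0 < sqrt (w T1)) by (apply sqrt_lt_R0; lra).
assert (i1 : f1 0 = x T1) by (change (x T1) with (sqrt (w T1) * cos (psi T1)); rewrite hca; field; lra).
assert (i2 : f2 0 = y T1) by (change (y T1) with (sqrt (w T1) * sin (psi T1)); rewrite hsa; field; lra).
assert (hn := chord_norm K l P S kap hK hl bP bk 0).
assert (crossT : f1 0 * h2 0 - f2 0 * h1 0 = P T1).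
{ unfold fvel1, fvel2, de1, de2; rewrite ef1, ef2, u0, v0, sb0, cb0.
  unfold afr1, afr2.
  transitivity ((1 - mu) * (acs mu K l ^ 2 - asn mu K l ^ 2)
     + 2 * l * asn mu K l * (acs mu K l ^ 2 + asn mu K l ^ 2)); [ring|].
  rewrite hbb; unfold oP, moment; rewrite sT, cT.
  replace (cos (asin s) ^ 2) with (1 - s ^ 2) by lra.
  unfold s, aphase, asn, aden in *; field; lra. }
assert (dotpos : 0 <= f1 0 * h1 0 + f2 0 * h2 0).
{ unfold fvel1, fvel2, de1, de2; rewrite ef1, ef2, u0, v0, sb0, cb0.
  unfold afr1, afr2.
  replace (_ + _) with (2 * acs mu K l * (l * (asn mu K l ^ 2 + acs mu K l ^ 2)
     - (1 - mu) * asn mu K l)) by ring.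
  rewrite hbb.
  replace (l * _ - _) with (l * mu * (1 + K * (1 - mu)) / aden mu K l).
  - repeat apply Rmult_le_pos; try lra; left; apply Rinv_0_lt_compat; lra.
  - unfold asn, aden in *; field; lra. }
assert (nh := fvel_norm K l P S kap u v hK hl bP bk nuv 0).
assert (ST : 0 <= S T1).
{ unfold oS; rewrite cT; assert (hsp := speed_pos mu K (chi T1) ltac:(lra) ltac:(lra) ltac:(lra)).
  repeat apply Rmult_le_pos; lra. }
(* Radius, unit speed and angular momentum leave only the sign of the dot product open; both
   candidates are nonnegative. *)
assert (dotT : f1 0 * h1 0 + f2 0 * h2 0 = S T1).
{ assert (hSP := oSP mu K chi hmu hK hKmu T1).
  apply Rsqr_inj; trivial; unfold Rsqr.
  transitivity ((f1 0 ^ 2 + f2 0 ^ 2) * (h1 0 ^ 2 + h2 0 ^ 2) - (f1 0 * h2 0 - f2 0 * h1 0) ^ 2); [ring|].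
  rewrite nh, crossT, wT; lra. }
exists T1; split; [lra|].
apply (front_follows K mu l w P S kap x y u v hK hl bP bS bk ek dP dS dk dx dy du dv nxy nuv duv cuv T1);
  trivial.
- intros t; specialize (bw t); lra.
- change (u T1) with ((S T1 * x T1 - P T1 * y T1) / w T1); rewrite <- i1, <- i2, <- dotT, <- crossT, <- wT.
  transitivity ((f1 0 ^ 2 + f2 0 ^ 2) * h1 0 / (f1 0 ^ 2 + f2 0 ^ 2)); field; rewrite wT; lra.
- change (v T1) with ((S T1 * y T1 + P T1 * x T1) / w T1); rewrite <- i1, <- i2, <- dotT, <- crossT, <- wT.
  transitivity ((f1 0 ^ 2 + f2 0 ^ 2) * h2 0 / (f1 0 ^ 2 + f2 0 ^ 2)); field; rewrite wT; lra.
Qed.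
(** A continuous angle of the chord direction: the first three terms give the direction of the
    velocity, the last adds the chord angle. Both arctangents are legitimate because [P] and [cb]
    are positive. *)
Definition tangle t := psi t + PI / 2 - atan (S t / P t) + atan (sb t / cb t).

Lemma cos_sin_tangle t : cos (tangle t) = e1 t /\ sin (tangle t) = e2 t.
Proof.
assert (hP := bP t); assert (hw := bw t).
assert (hc := ccos_pos K l P S kap hK hl bP bk t).
assert (hn := chord_norm K l P S kap hK hl bP bk t).
assert (hSP := oSP mu K chi hmu hK hKmu t).
destruct (cos_sin_atan_div (P t) (S t) ltac:(lra)) as [ca sa].
destruct (cos_sin_atan_div (cb t) (sb t) hc) as [cb' sb'].
replace (cb t ^ 2 + sb t ^ 2) with 1 in cb', sb' by lra.
rewrite sqrt_1 in cb', sb'.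
replace (P t ^ 2 + S t ^ 2) with (w t) in ca, sa by lra.
assert (hq : 0 < sqrt (w t)) by (apply sqrt_lt_R0; lra).
assert (hqq : sqrt (w t) * sqrt (w t) = w t) by (apply sqrt_sqrt; lra).
set (a := psi t + PI / 2 - atan (S t / P t)).
assert (ha : cos a = u t /\ sin a = v t).
{ unfold a; replace (psi t + PI / 2 - atan (S t / P t)) with (PI / 2 + (psi t - atan (S t / P t))) by ring.
  rewrite cos_plus, sin_plus, cos_PI2, sin_PI2, cos_minus, sin_minus, ca, sa.
  replace (u t) with ((S t * (sqrt (w t) * cos (psi t)) - P t * (sqrt (w t) * sin (psi t)))
    / (sqrt (w t) * sqrt (w t))) by (rewrite hqq; reflexivity).
  replace (v t) with ((S t * (sqrt (w t) * sin (psi t)) + P t * (sqrt (w t) * cos (psi t)))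
    / (sqrt (w t) * sqrt (w t))) by (rewrite hqq; reflexivity).
  split; field; lra. }
destruct ha as [ha1 ha2].
unfold tangle; fold a; rewrite cos_plus, sin_plus, ha1, ha2, cb', sb'.
unfold de1, de2; split; field.
Qed.

(** The arctangents need not be differentiated explicitly: the cosine and sine of [tangle] are the
    chord direction, whose derivative is known. *)
Lemma tangle_derive (t : R) : is_derive tangle t (sb t / l).
Proof.
assert (hP := bP t); assert (hc := ccos_pos K l P S kap hK hl bP bk t).
destruct (chord_derive K l P S kap hK hl bP bk dP dS dk t) as [dc ds].
destruct (de_derive K l P S kap u v hK hl bP bk dP dS dk du dv t) as [d1 d2].
assert (dq := opsi_derive mu K chi hmu hK hKmu hchi t).
assert (he : exists d : R, is_derive tangle t d).
{ change (ex_derive tangle t); unfold tangle; auto_derive; repeat split; try lra;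
  first [ex_derive_by dc | ex_derive_by ds | ex_derive_by (dP t) | ex_derive_by (dS t) | ex_derive_by dq]. }
destruct he as [d he].
assert (g1 : is_derive (fun r => cos (tangle r)) t (- sin (tangle t) * d)).
{ auto_derive; [ex_derive_by he|subst_derive he; ring]. }
assert (g2 : is_derive (fun r => sin (tangle r)) t (cos (tangle t) * d)).
{ auto_derive; [ex_derive_by he|subst_derive he; ring]. }
assert (g1' : is_derive (fun r => cos (tangle r)) t (- (sb t / l) * e2 t)).
{ apply (is_derive_ext e1); [intros r; symmetry; apply cos_sin_tangle|exact d1]. }
assert (g2' : is_derive (fun r => sin (tangle r)) t (sb t / l * e1 t)).
{ apply (is_derive_ext e2); [intros r; symmetry; apply cos_sin_tangle|exact d2]. }
assert (k1 := is_derive_unique _ _ _ g1); rewrite (is_derive_unique _ _ _ g1') in k1.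
assert (k2 := is_derive_unique _ _ _ g2); rewrite (is_derive_unique _ _ _ g2') in k2.
destruct (cos_sin_tangle t) as [r1 r2]; rewrite r1 in k2; rewrite r2 in k1.
assert (hn := de_norm K l P S kap u v hK hl bP bk nuv t).
replace (sb t / l) with d; [exact he|].
transitivity (d * (e1 t ^ 2 + e2 t ^ 2)); [rewrite hn; ring|].
transitivity (sb t / l * (e1 t ^ 2 + e2 t ^ 2)); [|rewrite hn; ring].
transitivity (e1 t * (e1 t * d) - e2 t * (- e2 t * d)); [ring|].
rewrite <- k1, <- k2; ring.
Qed.

Lemma chi_period (k : nat) t : chi (t + INR k * T) = chi t + 2 * INR k * PI.
Proof.
induction k as [|k IH]; [simpl; rewrite Rmult_0_l, Rplus_0_r; ring|].
rewrite S_INR; replace (t + (INR k + 1) * T) with (t + INR k * T + T) by ring.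
rewrite hT, IH; ring.
Qed.

Lemma psi_period (k : nat) t : psi (t + INR k * T) = psi t + INR k * (2 * PI / INR N).
Proof.
induction k as [|k IH]; [simpl; rewrite !Rmult_0_l, !Rplus_0_r; reflexivity|].
rewrite S_INR; replace (t + (INR k + 1) * T) with (t + INR k * T + T) by ring.
unfold opsi in *; rewrite hT, hpolar, IH; ring.
Qed.

(** The chord turns at the mean of the field strengths at its two ends, since its front end lies on
    the orbit. This bounds [sb / l] and shows later that it varies. *)
Lemma track_half_turn : forall t tau,
  (forall s, f1 s = x (s + tau) /\ f2 s = y (s + tau)) ->
  2 * (sb t / l) = kap t + kap (t + tau).
Proof.
intros t tau h; destruct (h t) as [h3 h4].
assert (ht := turning_rate K mu l w P S kap x y u v hK hl bP bk ek nxy nuv duv cuv t).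
rewrite h3, h4, nxy in ht; rewrite (ek (t + tau)); lra.
Qed.

Lemma ambiguous_track_exists : 0 < T -> exists L tau k m1' m2' th cb' sb',
  ambiguous_track l L tau k m1' m2' th cb' sb'.
Proof.
intros hT0; destruct track_front as [tau [hs hf]].
assert (hNR : 0 < INR N) by now apply lt_0_INR.
set (L := INR N * T).
assert (pc : forall t, chi (t + L) = chi t + 2 * INR N * PI) by (intros t; apply chi_period).
assert (pq : forall t, psi (t + L) = psi t + 2 * PI)
  by (intros t; unfold L; rewrite psi_period; field; lra).
assert (psin : forall t, sin (chi (t + L)) = sin (chi t)) by (intros t; rewrite pc; apply sin_period).
assert (pcos : forall t, cos (chi (t + L)) = cos (chi t)) by (intros t; rewrite pc; apply cos_period).
assert (pw : forall t, w (t + L) = w t) by (intros t; unfold ow, rad2; now rewrite psin).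
assert (pP : forall t, P (t + L) = P t) by (intros t; unfold oP, moment; now rewrite psin, pcos).
assert (pS : forall t, S (t + L) = S t)
  by (intros t; unfold oS, speed, speed2; now rewrite psin, pcos).
assert (pk : forall t, kap (t + L) = kap t) by (intros t; unfold okap; now rewrite psin).
assert (pcb : forall t, cb (t + L) = cb t)
  by (intros t; unfold ccos, cdisc, cE, cF, cG; now rewrite pP, pS, pk).
assert (psb : forall t, sb (t + L) = sb t)
  by (intros t; unfold csin, cdisc, cE, cF, cG; now rewrite pP, pS, pk).
assert (pth : forall t, tangle (t + L) = tangle t + 2 * PI)
  by (intros t; unfold tangle; rewrite pq, pcb, psb, pP, pS; ring).
assert (px : forall t, x (t + L) = x t).
{ intros t; change (sqrt (w (t + L)) * cos (psi (t + L)) = sqrt (w t) * cos (psi t)).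
  now rewrite pw, pq, cos_plus, sin_2PI, cos_2PI, Rmult_1_r, Rmult_0_r, Rminus_0_r. }
assert (py : forall t, y (t + L) = y t).
{ intros t; change (sqrt (w (t + L)) * sin (psi (t + L)) = sqrt (w t) * sin (psi t)).
  now rewrite pw, pq, sin_plus, sin_2PI, cos_2PI, Rmult_1_r, Rmult_0_r, Rplus_0_r. }
assert (pe : forall t, e1 (t + L) = e1 t /\ e2 (t + L) = e2 t).
{ intros t; destruct (cos_sin_tangle t) as [<- <-]; destruct (cos_sin_tangle (t + L)) as [<- <-].
  rewrite pth, cos_plus, sin_plus, sin_2PI, cos_2PI; split; ring. }
assert (csb : forall t, 15 / 16 <= sb t / l <= 17 / 16).
{ intros t; assert (h := track_half_turn t tau hf); assert (b1 := bk t); assert (b2 := bk (t + tau)); lra. }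
assert (bsb : forall t, 0 < sb t <= 17 / 64).
{ intros t; specialize (csb t); replace (sb t) with (l * (sb t / l)) by (field; lra); nra. }
assert (bcb : forall t, 96 / 100 <= cb t <= 1).
{ intros t; assert (hc := ccos_pos K l P S kap hK hl bP bk t).
  assert (hn := chord_norm K l P S kap hK hl bP bk t); specialize (bsb t); split; nra. }
assert (hmd := mid_dot K l P S kap x y u v hK hl bP bk nuv duv cuv).
assert (hmc := mid_cross K l P S kap x y u v duv cuv).
assert (hne : forall t, sb t / l * P t - 1 <= 74 / 1000 /\ - (74 / 1000) <= sb t / l * P t - 1).
{ intros t; specialize (csb t); assert (b := bP t); split; nra. }
assert (hme : forall t, m1 t - l * e1 t = x t /\ m2 t - l * e2 t = y t)
  by (intros t; unfold mid1, mid2; split; ring).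
assert (hmf : forall t, m1 t + l * e1 t = f1 t /\ m2 t + l * e2 t = f2 t)
  by (intros t; unfold mid1, mid2, front1, front2; split; ring).
(* Expressed through the midpoint, the constraint closes the system: the derivatives of [cb] and
   [sb] become polynomials in the recorded functions, from which smoothness will follow. *)
assert (hturn : forall t, sb t / l - kap t = K * l * (m1 t * e1 t + m2 t * e2 t)).
{ intros t; rewrite hmd; assert (h := chord_constraint K l P S kap hK hl bP bk t).
  unfold cE, cF, cG in h; apply Rmult_eq_reg_l with l; [|lra].
  replace (l * (sb t / l - kap t)) with (sb t - l * kap t) by (field; lra); lra. }
assert (hcos : forall t, cos (tangle t) = e1 t) by (intros t; apply cos_sin_tangle).
assert (hsin : forall t, sin (tangle t) = e2 t) by (intros t; apply cos_sin_tangle).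
exists L, tau, (K * l), m1, m2, tangle, cb, sb; constructor; trivial;
  try (intros t; progress rewrite ?hcos, ?hsin).
- now apply Rmult_lt_0_compat.
- now apply (mid_derive K l P S kap x y u v hK hl bP bk dP dS dk dx dy du dv).
- now apply (mid_derive K l P S kap x y u v hK hl bP bk dP dS dk dx dy du dv).
- exact tangle_derive.
- rewrite <- hturn; now apply (chord_derive K l P S kap hK hl bP bk dP dS dk).
- rewrite <- hturn; now apply (chord_derive K l P S kap hK hl bP bk dP dS dk).
- intros t; destruct (pe t) as [h _]; unfold mid1; now rewrite px, h.
- intros t; destruct (pe t) as [_ h]; unfold mid2; now rewrite py, h.
- intros t; apply bcb.
- exact (chord_norm K l P S kap hK hl bP bk).
- rewrite hmc; specialize (bcb t); specialize (bsb t); assert (b1 := bP t); assert (b2 := bS t).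
  assert (96 / 100 * (99 / 100) <= cb t * P t) by (apply Rmult_le_compat; lra).
  nra.
- rewrite hmd; specialize (bcb t); assert (b2 := bS t); specialize (hne t).
  replace (sb t) with (l * (sb t / l)) by (field; lra).
  assert (- (1 / 50) <= cb t * S t <= 1 / 50) by (split; nra).
  apply Rabs_le; split; nra.
- rewrite hmc; specialize (bcb t); specialize (bsb t); assert (b2 := bS t); specialize (hne t); specialize (csb t).
  replace (cb t - sb t / l * (cb t * P t + sb t * S t)) with
    (- cb t * (sb t / l * P t - 1) - sb t / l * (sb t * S t)) by ring.
  assert (- (17 / 64 * (1 / 50)) <= sb t * S t <= 17 / 64 * (1 / 50)) by (split; nra).
  assert (- (1 / 100) <= sb t / l * (sb t * S t) <= 1 / 100) by (split; nra).
  apply Rabs_le; split; nra.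
- destruct (hme t) as [-> ->]; rewrite nxy; apply bw.
- destruct (hme (t + tau)) as [-> _].
  destruct (hmf t) as [-> _]; apply hf.
- destruct (hme (t + tau)) as [_ ->].
  destruct (hmf t) as [_ ->]; apply hf.
(* Compare chords with the rear end at a pericentre and at an apocentre: equal turning rates would
   force [sin (chi tau) = 2 + sin (chi (t' + tau))], which is at least 1. *)
- intros hc; destruct (hsurj (PI / 2)) as [t' ht'].
  assert (k1 := track_half_turn 0 tau hf); assert (k2 := track_half_turn t' tau hf).
  rewrite (hc 0 t'), k2, Rplus_0_l in k1; unfold okap in k1.
  rewrite ht', hchi0, sin_PI2 in k1; replace (- PI / 2) with (- (PI / 2)) in k1 by field.
  rewrite sin_neg, sin_PI2 in k1.
  assert (hKm : 0 < K * mu) by (apply Rmult_lt_0_compat; lra).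
  destruct (SIN_bound (chi (t' + tau))).
  nra.
Qed.

End Track.

Lemma exists_ambiguous_track (lmax : R) : 0 < lmax ->
  exists l L tau k m1 m2 th cb sb, l <= lmax /\ ambiguous_track l L tau k m1 m2 th cb sb.
Proof.
intros hlm.
(* 40 is the threshold of the matching lemma; [10 / lmax] makes [l <= 10 / n] at most [lmax]. *)
destruct (INR_unbounded (40 + 10 / lmax)) as [N hN].
assert (h10 : 0 < 10 / lmax) by (apply Rdiv_lt_0_compat; lra).
set (n := INR N) in *.
assert (hn : 40 <= n) by lra.
(* Since [K] will be at most [n ^ 2 + 2 * n], this gives [K * mu <= 1 / 16]. *)
set (mu := / (16 * (n ^ 2 + 2 * n))).
assert (hN0 : 1088 <= n ^ 2 + 2 * n) by nra.
assert (hmN : mu * (n ^ 2 + 2 * n) = 1 / 16) by (unfold mu; field; nra).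
assert (hmu0 : 0 < mu) by (apply Rinv_0_lt_compat; lra).
assert (hmu1 : mu <= 1 / 240) by nra.
destruct (exists_closing n mu ltac:(lra) eq_refl) as [K [hK hp]].
assert (hK15 : 15 <= K) by nra.
assert (hKm : K * mu <= 1 / 16) by nra.
destruct (exists_matching mu K (conj hmu0 hmu1) hK15 hKm n hn hp) as [l [hl hm]].
assert (hn1 : 0 < / n <= 1 / 40).
{ split; [apply Rinv_0_lt_compat; lra|]; replace (1 / 40) with (/ 40) by field; apply Rinv_le_contravar; lra. }
assert (hl4 : 0 < l <= 1 / 4) by (unfold Rdiv in hl; lra).
assert (hll : l <= lmax).
{ apply Rle_trans with (10 / n); [lra|].
  apply Rmult_le_reg_r with n; [lra|].
  replace (10 / n * n) with (10 / lmax * lmax) by (field; lra).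
  rewrite (Rmult_comm lmax); apply Rmult_le_compat_r; lra. }
destruct (exists_phase mu K ltac:(lra) ltac:(lra) ltac:(lra)) as [chi [T [hT0 [hc0 [hc [hT hsurj]]]]]].
assert (hNpos : (0 < N)%nat) by (apply INR_lt; simpl; fold n; lra).
assert (hpol := polar_shift mu K _ ltac:(lra) ltac:(lra) ltac:(lra) hp).
destruct (ambiguous_track_exists mu K l T N chi (conj hmu0 hmu1) hK15 hKm hNpos hl4 hc hc0 hT hsurj hpol hm hT0)
  as [L [tau [k [m1 [m2 [th [cb [sb h]]]]]]]].
now exists l, L, tau, k, m1, m2, th, cb, sb.
Qed.

(** * Convex tables *)

Lemma period_Z (f : R -> R) (P0 : R) : (forall t, f (t + P0) = f t) ->
  forall (k : Z) t, f (t + IZR k * P0) = f t.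
Proof.
intros hf; induction k as [|k IH|k IH] using Z.peano_ind; intros t.
- now rewrite Rmult_0_l, Rplus_0_r.
- rewrite succ_IZR; replace (t + (IZR k + 1) * P0) with (t + IZR k * P0 + P0) by ring.
  now rewrite hf.
- rewrite <- (IH t), <- (hf (t + IZR (Z.pred k) * P0)); f_equal.
  unfold Z.pred; rewrite plus_IZR; ring.
Qed.

Lemma cos_period_Z (k : Z) x : cos (x + IZR k * (2 * PI)) = cos x.
Proof. apply period_Z; intros t; rewrite cos_plus, sin_2PI, cos_2PI; ring. Qed.

Lemma sin_period_Z (k : Z) x : sin (x + IZR k * (2 * PI)) = sin x.
Proof. apply period_Z; intros t; rewrite sin_plus, sin_2PI, cos_2PI; ring. Qed.

Lemma reduce_period (P0 a b : R) : 0 < P0 -> exists k : Z, a <= b + IZR k * P0 < a + P0.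
Proof.
intros hP; destruct (archimed ((a - b) / P0)) as [h1 h2].
assert (e : (a - b) / P0 * P0 = a - b) by (field; lra).
set (z := (a - b) / P0) in *; set (u := IZR (up z)) in *.
destruct (Rle_lt_dec (a + P0) (b + u * P0)) as [h|h].
(* [up z] exceeds [z] by at most 1, possibly by exactly 1, which would hit the excluded right
   end. *)
- exists (up z - 1)%Z; rewrite minus_IZR; fold u; split; nra.
- exists (up z); fold u; split; [nra|lra].
Qed.

Lemma Rmult_unit_lt (a b e : R) : Rabs a < e -> - 1 <= b <= 1 -> a * b < e.
Proof.
intros ha hb; apply Rle_lt_trans with (Rabs a); trivial.
eapply Rle_trans; [apply Rle_abs|]; rewrite Rabs_mult.
rewrite <- (Rmult_1_r (Rabs a)) at 2; apply Rmult_le_compat_l; [apply Rabs_pos|].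
apply Rabs_le; lra.
Qed.

Section SupportCurve.
Variables (g1 g2 th lam om : R -> R) (L : R).
Hypothesis hL : 0 < L.
Hypothesis dg1 : forall t : R, is_derive g1 t (lam t * cos (th t)).
Hypothesis dg2 : forall t : R, is_derive g2 t (lam t * sin (th t)).
Hypothesis dth : forall t : R, is_derive th t (om t).
Hypothesis hom : forall t, 15 / 16 <= om t <= 17 / 16.
Hypothesis hlam : forall t, om t / 2 <= lam t.
Hypothesis g1L : forall t, g1 (t + L) = g1 t.
Hypothesis g2L : forall t, g2 (t + L) = g2 t.
Hypothesis thL : forall t, th (t + L) = th t + 2 * PI.

(** [(sin th, - cos th)] is the outward normal, so [table] is the intersection of the open
    half-planes behind all tangent lines. *)
Definition support t := g1 t * sin (th t) - g2 t * cos (th t).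
Definition table (p1 p2 : R) := forall t, p1 * sin (th t) - p2 * cos (th t) < support t.

Hypothesis hsupp : forall t, 1 / 2 <= support t.

Lemma shift_period (k : Z) t :
  g1 (t + IZR k * L) = g1 t /\ g2 (t + IZR k * L) = g2 t /\
  th (t + IZR k * L) = th t + IZR k * (2 * PI).
Proof.
split; [now apply period_Z|split; [now apply period_Z|]].
assert (h := period_Z (fun s => th s - s / L * (2 * PI)) L); cbv beta in h.
assert (h' : forall s, th (s + L) - (s + L) / L * (2 * PI) = th s - s / L * (2 * PI))
  by (intros s; rewrite thL; field; lra).
specialize (h h' k t).
replace ((t + IZR k * L) / L) with (t / L + IZR k) in h by (field; lra). lra.
Qed.

Lemma th_lt s t : s < t -> th s < th t.
Proof.
intros h; apply (derive_pos_lt th om); trivial; intros x _.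
specialize (hom x); lra.
Qed.

Lemma th_le_inv s t : th s <= th t -> s <= t.
Proof.
intros h; destruct (Rle_lt_dec s t) as [h'|h']; trivial.
apply th_lt in h'; lra.
Qed.

Lemma th_surj a : exists t, th t = a.
Proof.
destruct (reduce_period (2 * PI) a (th 0)) as [k hk]; [assert (h := PI_RGT_0); lra|].
destruct (shift_period k 0) as [_ [_ e]]; rewrite <- e in hk.
destruct (shift_period (k - 1) 0) as [_ [_ e']].
set (t1 := 0 + IZR (k - 1) * L) in *; set (t2 := 0 + IZR k * L) in *.
assert (e2 : th t2 = th t1 + 2 * PI) by (rewrite e, e', minus_IZR; ring).
assert (hPI := PI_RGT_0).
destruct (Req_dec (th t2) a) as [h|h]; [now exists t2|].
destruct (IVT_interv (fun t => th t - a) t1 t2) as [z [_ hz]].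
- intros x _; apply continuity_pt_minus; [|apply continuity_pt_const; now intros ? ?].
  exact (is_derive_continuity_pt _ _ _ (dth x)).
- unfold t1, t2; rewrite minus_IZR; lra.
- lra.
- lra.
- exists z; lra.
Qed.

(* The derivative of [v |-> g v . n t] is [lam v * sin (th t - th v)]. *)
Lemma support_gap_near s t : - PI <= th t - th s <= PI ->
  1 / 2 * (1 - cos (th t - th s)) <= support t - (g1 s * sin (th t) - g2 s * cos (th t)).
Proof.
intros h.
(* Subtracting the cosine compares the curve with a circle of radius 1/2, the lower bound on the
   radius of curvature [lam / om]; the difference is monotone on the half turn on either side of
   [t]. *)
pose (f := fun v => g1 v * sin (th t) - g2 v * cos (th t) - 1 / 2 * cos (th t - th v)).
assert (df : forall v : R, is_derive f v ((lam v - om v / 2) * sin (th t - th v))).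
{ intros v; unfold f; auto_derive.
  - repeat split; first [ex_derive_by (dg1 v)|ex_derive_by (dg2 v)|ex_derive_by (dth v)].
  - subst_derive (dg1 v); subst_derive (dg2 v); subst_derive (dth v).
    unfold Rminus; rewrite sin_plus, sin_neg, cos_neg; field. }
assert (ft : f t = support t - 1 / 2) by (unfold f, support; rewrite Rminus_diag, cos_0; ring).
cut (f s <= f t); [rewrite ft; unfold f; lra|].
destruct (Rle_lt_dec s t) as [hst|hst].
- apply (derive_nonneg_le f (fun v => (lam v - om v / 2) * sin (th t - th v)) s t hst); [intros v _; apply df|].
  intros v hv; cbv beta; apply Rmult_le_pos; [specialize (hlam v); lra|].
  assert (h1 : th s <= th v) by (destruct (Req_dec s v) as [->|]; [lra|left; apply th_lt; lra]).
  assert (h2 : th v <= th t) by (destruct (Req_dec v t) as [->|]; [lra|left; apply th_lt; lra]).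
  apply sin_ge_0; lra.
- apply Ropp_le_cancel.
  apply (derive_nonneg_le (fun v => - f v) (fun v => - ((lam v - om v / 2) * sin (th t - th v))) t s); [lra| |].
  + intros v _; auto_derive; [ex_derive_by (df v)|subst_derive (df v); ring].
  + intros v hv.
    assert (h1 : th t <= th v) by (destruct (Req_dec t v) as [->|]; [lra|left; apply th_lt; lra]).
    assert (h2 : th v <= th s) by (destruct (Req_dec v s) as [->|]; [lra|left; apply th_lt; lra]).
    replace (sin (th t - th v)) with (- sin (th v - th t))
      by (rewrite <- sin_neg; f_equal; ring).
    assert (0 <= sin (th v - th t)) by (apply sin_ge_0; lra).
    specialize (hlam v); nra.
Qed.

Lemma support_gap s t :
  1 / 2 * (1 - cos (th t - th s)) <= support t - (g1 s * sin (th t) - g2 s * cos (th t)).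
Proof.
assert (hPI := PI_RGT_0).
destruct (reduce_period (2 * PI) (- PI) (th s - th t)) as [k hk]; [lra|].
destruct (shift_period k s) as [e1 [e2 e3]].
assert (h := support_gap_near (s + IZR k * L) t); rewrite e1, e2, e3 in h.
rewrite <- (cos_period_Z (- k)), opp_IZR.
replace (th t - th s + - IZR k * (2 * PI)) with (th t - (th s + IZR k * (2 * PI))) by ring.
apply h; lra.
Qed.

Lemma cos_eq_1_small x : Rabs x < 2 * PI -> cos x = 1 -> x = 0.
Proof.
intros hx hc; apply Rabs_def2 in hx.
replace x with (2 * (x / 2)) in hc by field; rewrite cos_2a_sin in hc.
assert (hs : sin (x / 2) = 0) by nra.
destruct (Rtotal_order x 0) as [h|[h|h]]; trivial.
- assert (0 < sin (- (x / 2))) by (apply sin_gt_0; lra). rewrite sin_neg in *; lra.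
- assert (0 < sin (x / 2)) by (apply sin_gt_0; lra). lra.
Qed.

Lemma curve_inj s t : Rabs (s - t) < L -> g1 s = g1 t -> g2 s = g2 t -> s = t.
Proof.
intros hst h1 h2; apply Rabs_def2 in hst.
assert (h := support_gap s t); rewrite h1, h2 in h; unfold support in h.
assert (hc : cos (th t - th s) = 1) by (destruct (COS_bound (th t - th s)); lra).
assert (hlt : Rabs (th t - th s) < 2 * PI).
{ assert (a1 := th_lt s (t + L) ltac:(lra)); assert (a2 := th_lt t (s + L) ltac:(lra)).
  rewrite thL in a1, a2; apply Rabs_def1; lra. }
apply cos_eq_1_small in hc; trivial.
apply Rle_antisym; apply th_le_inv; lra.
Qed.

Lemma curve_not_table t : ~ table (g1 t) (g2 t).
Proof. intros h; specialize (h t); unfold support in h; lra. Qed.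

Lemma curve_le_support s t : g1 s * sin (th t) - g2 s * cos (th t) <= support t.
Proof. assert (h := support_gap s t); destruct (COS_bound (th t - th s)); lra. Qed.

Lemma table_scale c p1 p2 : 0 <= c < 1 ->
  (forall t, p1 * sin (th t) - p2 * cos (th t) <= support t) -> table (c * p1) (c * p2).
Proof. intros hc h t; specialize (h t); specialize (hsupp t); nra. Qed.

(** A disc of radius 1/2 rolls inside the table; the slack is [1 / 2 * (1 - cos) + h * cos >= h]. *)
Lemma table_inward t h : 0 < h < 1 / 2 ->
  table (g1 t - h * sin (th t)) (g2 t + h * cos (th t)).
Proof.
intros hh s; assert (hg := support_gap t s).
replace ((g1 t - h * sin (th t)) * sin (th s) - (g2 t + h * cos (th t)) * cos (th s))
  with (g1 t * sin (th s) - g2 t * cos (th s) - h * cos (th s - th t))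
  by (rewrite cos_minus; ring).
destruct (COS_bound (th s - th t)); nra.
Qed.

Lemma support_derive t : is_derive support t (om t * (g1 t * cos (th t) + g2 t * sin (th t))).
Proof.
unfold support; auto_derive.
- repeat split; first [ex_derive_by (dg1 t)|ex_derive_by (dg2 t)|ex_derive_by (dth t)].
- subst_derive (dg1 t); subst_derive (dg2 t); subst_derive (dth t); ring.
Qed.

Lemma gap_derive p1 p2 (t : R) :
  is_derive (fun s => support s - (p1 * sin (th s) - p2 * cos (th s))) t
    (om t * ((g1 t - p1) * cos (th t) + (g2 t - p2) * sin (th t))).
Proof.
assert (ds := support_derive t); auto_derive.
- repeat split; first [ex_derive_by ds|ex_derive_by (dth t)].
- subst_derive ds; subst_derive (dth t); ring.
Qed.

(** By periodicity and compactness the gap to the infinitely many tangent lines attains a positive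
    minimum [d]; moving each coordinate by less than [d / 2] cannot exhaust it. *)
Lemma table_open p1 p2 : table p1 p2 -> exists eps, 0 < eps /\
  forall q1 q2, Rabs (q1 - p1) < eps -> Rabs (q2 - p2) < eps -> table q1 q2.
Proof.
intros hp.
destruct (continuity_ab_min (fun s => support s - (p1 * sin (th s) - p2 * cos (th s))) 0 L)
  as [t0 [hmin _]]; [lra| |].
- intros t _; exact (is_derive_continuity_pt _ _ _ (gap_derive p1 p2 t)).
- set (d := support t0 - (p1 * sin (th t0) - p2 * cos (th t0))) in *.
  assert (hd : 0 < d) by (specialize (hp t0); unfold d; lra).
  exists (d / 2); split; [lra|]; intros q1 q2 h1 h2 t.
  destruct (reduce_period L 0 t hL) as [k hk].
  specialize (hmin (t + IZR k * L) ltac:(lra)).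
  destruct (shift_period k t) as [e1 [e2 e3]].
  change (support (t + IZR k * L)) with (g1 (t + IZR k * L) * sin (th (t + IZR k * L))
    - g2 (t + IZR k * L) * cos (th (t + IZR k * L))) in hmin.
  rewrite e1, e2, e3, sin_period_Z, cos_period_Z in hmin; fold (support t) in hmin.
  assert (k1 := Rmult_unit_lt _ _ _ h1 (SIN_bound (th t))).
  rewrite <- Rabs_Ropp in h2; assert (k2 := Rmult_unit_lt _ _ _ h2 (COS_bound (th t))).
  lra.
Qed.

(** The gap is minimal at [t], so its derivative kills the tangential part of [g t - p]; the normal
    part is the gap itself, which is zero. *)
Lemma support_touch p1 p2 t : (forall s, p1 * sin (th s) - p2 * cos (th s) <= support s) ->
  support t <= p1 * sin (th t) - p2 * cos (th t) -> p1 = g1 t /\ p2 = g2 t.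
Proof.
intros hp ht.
assert (hd := gap_derive p1 p2 t).
assert (pr : derivable_pt (fun s => support s - (p1 * sin (th s) - p2 * cos (th s))) t)
  by (exists (om t * ((g1 t - p1) * cos (th t) + (g2 t - p2) * sin (th t))); now apply is_derive_Reals).
assert (h0 := deriv_minimum _ (t - 1) (t + 1) t pr ltac:(lra) ltac:(lra)).
assert (e1 : om t * ((g1 t - p1) * cos (th t) + (g2 t - p2) * sin (th t)) = 0).
{ rewrite <- (is_derive_unique _ _ _ hd).
  etransitivity; [symmetry; apply (Derive_Reals _ t pr)|].
  apply h0; intros s _ _; specialize (hp s); lra. }
assert (e2 : (g1 t - p1) * sin (th t) - (g2 t - p2) * cos (th t) = 0).
{ specialize (hp t); unfold support in hp, ht; lra. }
assert (ho := hom t); apply Rmult_integral in e1; destruct e1 as [e1|e1]; [lra|].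
assert (hcs := sin2_cos2 (th t)); unfold Rsqr in hcs.
set (s := sin (th t)) in *; set (c := cos (th t)) in *.
split.
- assert (g1 t - p1 = c * ((g1 t - p1) * c + (g2 t - p2) * s) + s * ((g1 t - p1) * s - (g2 t - p2) * c)).
  { transitivity ((g1 t - p1) * (s * s + c * c)); [rewrite hcs; ring|ring]. }
  rewrite e1, e2 in *; lra.
- assert (g2 t - p2 = s * ((g1 t - p1) * c + (g2 t - p2) * s) - c * ((g1 t - p1) * s - (g2 t - p2) * c)).
  { transitivity ((g2 t - p2) * (s * s + c * c)); [rewrite hcs; ring|ring]. }
  rewrite e1, e2 in *; lra.
Qed.

(** The four tangent lines parallel to the axes form a box. *)
Lemma table_bounded : exists M, forall p1 p2, table p1 p2 -> Rabs p1 <= M /\ Rabs p2 <= M.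
Proof.
destruct (th_surj 0) as [t1 h1]; destruct (th_surj (PI / 2)) as [t2 h2].
destruct (th_surj PI) as [t3 h3]; destruct (th_surj (- (PI / 2))) as [t4 h4].
exists (support t1 + support t2 + support t3 + support t4); intros p1 p2 hp.
assert (k1 := hp t1); assert (k2 := hp t2); assert (k3 := hp t3); assert (k4 := hp t4).
rewrite h1, sin_0, cos_0 in k1; rewrite h2, sin_PI2, cos_PI2 in k2.
rewrite h3, sin_PI, cos_PI in k3; rewrite h4, sin_neg, cos_neg, sin_PI2, cos_PI2 in k4.
assert (l1 := hsupp t1); assert (l2 := hsupp t2); assert (l3 := hsupp t3); assert (l4 := hsupp t4).
split; apply Rabs_le; lra.
Qed.

Lemma adherent_le_support p1 p2 :
  (forall eps, 0 < eps -> exists q1 q2, Rabs (q1 - p1) < eps /\ Rabs (q2 - p2) < eps /\ table q1 q2) ->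
  forall t, p1 * sin (th t) - p2 * cos (th t) <= support t.
Proof.
intros hp t; apply Rnot_lt_le; intros h.
set (d := p1 * sin (th t) - p2 * cos (th t) - support t).
destruct (hp (d / 2)) as [q1 [q2 [h1 [h2 hq]]]]; [unfold d; lra|].
specialize (hq t); rewrite <- Rabs_Ropp in h1.
assert (k1 := Rmult_unit_lt _ _ _ h1 (SIN_bound (th t))).
assert (k2 := Rmult_unit_lt _ _ _ h2 (COS_bound (th t))).
unfold d in *; lra.
Qed.

Lemma adherent_boundary p1 p2 :
  (forall eps, 0 < eps -> exists q1 q2, Rabs (q1 - p1) < eps /\ Rabs (q2 - p2) < eps /\ table q1 q2) ->
  ~ table p1 p2 -> exists t, p1 = g1 t /\ p2 = g2 t.
Proof.
intros hp hn; apply not_all_ex_not in hn; destruct hn as [t ht].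
exists t; apply support_touch; [now apply adherent_le_support|lra].
Qed.

Lemma curve_adherent t eps : 0 < eps ->
  exists q1 q2, Rabs (q1 - g1 t) < eps /\ Rabs (q2 - g2 t) < eps /\ table q1 q2.
Proof.
intros he.
(* Including [eps] in [M] makes [d = eps / M] at most 1 and shrinking by [1 - d] a move of less than
   [eps]. *)
set (M := Rabs (g1 t) + Rabs (g2 t) + eps).
assert (p1 := Rabs_pos (g1 t)); assert (p2 := Rabs_pos (g2 t)).
assert (hd : 0 < eps / M <= 1).
{ split; [apply Rdiv_lt_0_compat; unfold M; lra|].
  apply Rmult_le_reg_r with M; [unfold M; lra|].
  replace (eps / M * M) with eps by (field; unfold M; lra); unfold M; lra. }
assert (hM : eps / M * M = eps) by (field; unfold M; lra).
set (d := eps / M) in *.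
exists ((1 - d) * g1 t), ((1 - d) * g2 t); repeat split.
- replace ((1 - d) * g1 t - g1 t) with (- (d * g1 t)) by ring.
  rewrite Rabs_Ropp, Rabs_mult, (Rabs_pos_eq d) by lra; unfold M in hM; nra.
- replace ((1 - d) * g2 t - g2 t) with (- (d * g2 t)) by ring.
  rewrite Rabs_Ropp, Rabs_mult, (Rabs_pos_eq d) by lra; unfold M in hM; nra.
- apply table_scale; [lra|intros s; apply curve_le_support].
Qed.

(* Distance from the curve to a fixed point [a]: its critical points are the
   zeros of [tang], which are simple because the curve is nearly a circle
   around the origin, so there are at most two of them in a period. *)
Section Distance.
Variables (a1 a2 : R).
Hypothesis ha : 98 / 100 <= a1 ^ 2 + a2 ^ 2.
Hypothesis hdot : forall t, Rabs (g1 t * cos (th t) + g2 t * sin (th t)) <= 1 / 10.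
Hypothesis hcurv : forall t, Rabs (lam t - om t * support t) <= 1 / 10.

Definition tang t := (g1 t - a1) * cos (th t) + (g2 t - a2) * sin (th t).
Definition nrm t := a1 * sin (th t) - a2 * cos (th t).

(** The first two terms cancel on a circle about the origin and are small by [hcurv]; where [nrm] is
    not small, it decides the sign. *)
Lemma tang_derive (t : R) : is_derive tang t (lam t - om t * support t + om t * nrm t).
Proof.
unfold tang; auto_derive.
- repeat split; first [ex_derive_by (dg1 t)|ex_derive_by (dg2 t)|ex_derive_by (dth t)].
- subst_derive (dg1 t); subst_derive (dg2 t); subst_derive (dth t).
  assert (h := sin2_cos2 (th t)); unfold Rsqr in h.
  replace (lam t) with (lam t * (sin (th t) * sin (th t) + cos (th t) * cos (th t))) at 3 by (rewrite h; ring).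
  unfold nrm, support; ring.
Qed.

Lemma tang_zero_nrm t : tang t = 0 -> 97 / 100 <= nrm t ^ 2 /\
  Rabs (a1 * cos (th t) + a2 * sin (th t)) <= 1 / 10.
Proof.
intros h; unfold tang in h.
assert (e : a1 * cos (th t) + a2 * sin (th t) = g1 t * cos (th t) + g2 t * sin (th t)) by lra.
assert (hd := hdot t); rewrite <- e in hd; split; trivial.
assert (hcs := sin2_cos2_pow (th t)).
assert (h2 : (a1 * cos (th t) + a2 * sin (th t)) ^ 2 <= (1 / 10) ^ 2)
  by (rewrite <- pow2_abs; apply pow_incr; split; [apply Rabs_pos|exact hd]).
assert (e2 : nrm t ^ 2 + (a1 * cos (th t) + a2 * sin (th t)) ^ 2 = a1 ^ 2 + a2 ^ 2).
{ transitivity ((a1 ^ 2 + a2 ^ 2) * (sin (th t) ^ 2 + cos (th t) ^ 2)); [unfold nrm; ring|rewrite hcs; ring]. }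
lra.
Qed.

(** As a function of the angle, [nrm] is a sinusoid. On an arc below a quarter turn it is
    interpolated by sines from its end values, so [c * nrm] stays above 98/100 and [c * tang]
    strictly increases. *)
Lemma tang_zeros_near c s t : (c = 1 \/ c = - 1) -> s < t -> th t - th s < PI / 2 ->
  98 / 100 <= c * nrm s -> 98 / 100 <= c * nrm t -> tang s = 0 -> tang t <> 0.
Proof.
intros hc hst hlt h1 h2 h3 h4.
assert (hD := th_lt s t hst).
assert (hlt' : c * tang s < c * tang t); [|rewrite h3, h4 in hlt'; lra].
apply (derive_pos_lt (fun r => c * tang r) (fun r => c * (lam r - om r * support r + om r * nrm r))); trivial.
- intros r _; assert (d := tang_derive r); auto_derive; [ex_derive_by d|subst_derive d; ring].
- intros r hr.
  assert (b1 : th s <= th r) by (destruct (Req_dec s r) as [->|]; [lra|left; apply th_lt; lra]).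
  assert (b2 : th r <= th t) by (destruct (Req_dec r t) as [->|]; [lra|left; apply th_lt; lra]).
  assert (hPI := PI_RGT_0).
  assert (sD : 0 < sin (th t - th s)) by (apply sin_gt_0; lra).
  assert (s1 : 0 <= sin (th t - th r)) by (apply sin_ge_0; lra).
  assert (s2 : 0 <= sin (th r - th s)) by (apply sin_ge_0; lra).
  assert (c1 : 0 <= cos (th t - th r) <= 1) by (split; [apply cos_ge_0; lra|apply COS_bound]).
  assert (c2 : 0 <= cos (th r - th s) <= 1) by (split; [apply cos_ge_0; lra|apply COS_bound]).
  assert (sub : sin (th t - th s) <= sin (th t - th r) + sin (th r - th s)).
  { replace (th t - th s) with ((th t - th r) + (th r - th s)) by ring; rewrite sin_plus; nra. }
  assert (e : sin (th t - th s) * nrm r = sin (th t - th r) * nrm s + sin (th r - th s) * nrm t).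
  { unfold nrm; rewrite !sin_minus; ring. }
  assert (hn : 98 / 100 <= c * nrm r).
  { apply Rmult_le_reg_l with (sin (th t - th s)); trivial.
    replace (sin (th t - th s) * (c * nrm r)) with (c * (sin (th t - th s) * nrm r)) by ring.
    rewrite e.
    replace (c * (sin (th t - th r) * nrm s + sin (th r - th s) * nrm t))
      with (sin (th t - th r) * (c * nrm s) + sin (th r - th s) * (c * nrm t)) by ring.
    nra. }
  assert (k := hcurv r); apply Rabs_le_between in k; assert (ko := hom r).
  replace (c * (lam r - om r * support r + om r * nrm r))
    with (c * (lam r - om r * support r) + om r * (c * nrm r)) by ring.
  assert (90 / 100 <= om r * (c * nrm r)) by nra.
  destruct hc as [-> | ->]; lra.
Qed.

Lemma tangL t : tang (t + L) = tang t.
Proof. unfold tang; now rewrite g1L, g2L, thL, sin_plus, cos_plus, sin_2PI, cos_2PI,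
  !Rmult_1_r, !Rmult_0_r, Rplus_0_r, Rminus_0_r. Qed.

Lemma nrmL t : nrm (t + L) = nrm t.
Proof. unfold nrm; now rewrite thL, sin_plus, cos_plus, sin_2PI, cos_2PI,
  !Rmult_1_r, !Rmult_0_r, Rplus_0_r, Rminus_0_r. Qed.

(** At a zero, [a] is almost normal to the curve. Equal signs of [nrm] would make the two tangent
    directions close, either directly or after passing from [s] to [s + L], and then the zeros could
    not be distinct. *)
Lemma tang_zeros_sign s t : s < t < s + L -> tang s = 0 -> tang t = 0 -> nrm s * nrm t < 0.
Proof.
intros hst h1 h2; apply Rnot_le_lt; intros hn.
destruct (tang_zero_nrm s h1) as [n1 p1]; destruct (tang_zero_nrm t h2) as [n2 p2].
assert (hc : exists c, (c = 1 \/ c = - 1) /\ 98 / 100 <= c * nrm s /\ 98 / 100 <= c * nrm t).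
{ destruct (Rle_lt_dec 0 (nrm s)) as [hs|hs].
  - exists 1; split; [now left|]; assert (0 <= nrm t) by nra; split; nra.
  - exists (- 1); split; [now right|]; assert (nrm t <= 0) by nra; split; nra. }
destruct hc as [c [hc [c1 c2]]].
assert (D1 := th_lt s t (proj1 hst)); assert (D2 := th_lt t (s + L) (proj2 hst)); rewrite thL in D2.
assert (hcos : 0 < cos (th t - th s)).
{ apply Rmult_lt_reg_l with (a1 ^ 2 + a2 ^ 2); [lra|].
  assert (hcs := sin2_cos2_pow (th s)).
  rewrite cos_minus.
  replace ((a1 ^ 2 + a2 ^ 2) * (cos (th t) * cos (th s) + sin (th t) * sin (th s)))
    with (nrm s * nrm t + (a1 * cos (th s) + a2 * sin (th s)) * (a1 * cos (th t) + a2 * sin (th t))) by (unfold nrm; ring).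
  assert (96 / 100 <= nrm s * nrm t).
  { assert ((c * nrm s) * (c * nrm t) = nrm s * nrm t) by (destruct hc as [-> | ->]; ring). nra. }
  apply Rabs_le_between in p1; apply Rabs_le_between in p2; nra. }
assert (hPI := PI_RGT_0).
destruct (Rle_lt_dec (PI / 2) (th t - th s)) as [hD|hD].
- destruct (Rle_lt_dec (th t - th s) (3 * (PI / 2))) as [hD'|hD'].
  + assert (cos (th t - th s) <= 0) by (apply cos_le_0; lra). lra.
  + apply (tang_zeros_near c t (s + L)); trivial; try lra.
    * rewrite thL; lra.
    * now rewrite nrmL.
    * now rewrite tangL.
- now apply (tang_zeros_near c s t).
Qed.

Definition dist2 t := (g1 t - a1) ^ 2 + (g2 t - a2) ^ 2.

Lemma dist2_rolle s t : s < t -> dist2 s = dist2 t -> exists z, s < z < t /\ tang z = 0.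
Proof.
intros hst he.
destruct (MVT_cor2 dist2 (fun r => 2 * lam r * tang r) s t hst) as [z [h1 h2]].
- intros r _; apply is_derive_Reals; unfold dist2, tang; auto_derive.
  + repeat split; first [ex_derive_by (dg1 r)|ex_derive_by (dg2 r)].
  + subst_derive (dg1 r); subst_derive (dg2 r); ring.
- exists z; split; trivial.
  rewrite he, Rminus_diag in h1; symmetry in h1.
  assert (b1 := hom z); assert (b2 := hlam z).
  apply Rmult_integral in h1; destruct h1 as [h1|h1]; [|lra].
  apply Rmult_integral in h1; destruct h1 as [h1|h1]; lra.
Qed.

Lemma dist2L t : dist2 (t + L) = dist2 t.
Proof. unfold dist2; now rewrite g1L, g2L. Qed.

(** Rolle on the three arcs of the closed curve gives three zeros of [tang], but only two signs of
    [nrm] are available. *)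
Lemma dist2_three p q r : p < q -> q < r -> r < p + L ->
  dist2 p = dist2 q -> dist2 q = dist2 r -> False.
Proof.
intros h1 h2 h3 e1 e2.
destruct (dist2_rolle p q h1 e1) as [z1 [i1 t1]].
destruct (dist2_rolle q r h2 e2) as [z2 [i2 t2]].
destruct (dist2_rolle r (p + L) h3) as [z3 [i3 t3]]; [rewrite dist2L; congruence|].
assert (s1 := tang_zeros_sign z1 z2 ltac:(lra) t1 t2).
assert (s2 := tang_zeros_sign z2 z3 ltac:(lra) t2 t3).
assert (s3 := tang_zeros_sign z1 z3 ltac:(lra) t1 t3).
assert (0 < nrm z1 * nrm z2 * (nrm z2 * nrm z3)) by nra.
assert (0 <= nrm z2 ^ 2) by apply pow2_ge_0.
nra.
Qed.

Lemma dist2_level s t u : dist2 s = dist2 t -> dist2 s = dist2 u ->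
  (exists k : Z, t = s + IZR k * L) \/ (exists k : Z, u = s + IZR k * L) \/
  (exists k : Z, u = t + IZR k * L).
Proof.
intros e1 e2.
destruct (reduce_period L s t hL) as [k hk]; destruct (reduce_period L s u hL) as [j hj].
assert (p1 := period_Z dist2 L dist2L k t); assert (p2 := period_Z dist2 L dist2L j u).
set (t' := t + IZR k * L) in *; set (u' := u + IZR j * L) in *.
destruct (Req_dec t' s) as [h1|h1].
{ left; exists (- k)%Z; rewrite opp_IZR; unfold t' in h1; lra. }
destruct (Req_dec u' s) as [h2|h2].
{ right; left; exists (- j)%Z; rewrite opp_IZR; unfold u' in h2; lra. }
destruct (Rtotal_order t' u') as [h3|[h3|h3]].
- exfalso; apply (dist2_three s t' u'); try lra; congruence.
- right; right; exists (k - j)%Z; rewrite minus_IZR; unfold t', u' in h3; lra.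
- exfalso; apply (dist2_three s u' t'); try lra; congruence.
Qed.

End Distance.

(** Differentiate the circle equation twice: the radius is normal to the curve, so [lam = om * N]
    with [N ^ 2 = rho ^ 2], and [lam > 0] fixes the sign. *)
Lemma circle_curvature c1 c2 rho : 0 < rho ->
  (forall t, (g1 t - c1) ^ 2 + (g2 t - c2) ^ 2 = rho ^ 2) -> forall t, lam t = rho * om t.
Proof.
intros hr hc t.
pose (f := fun t => (g1 t - c1) * cos (th t) + (g2 t - c2) * sin (th t)).
assert (f0 : forall s, f s = 0).
{ intros s.
  assert (h1 : is_derive (fun r => (g1 r - c1) ^ 2 + (g2 r - c2) ^ 2) s (2 * lam s * f s)).
  { unfold f; auto_derive.
    - repeat split; first [ex_derive_by (dg1 s)|ex_derive_by (dg2 s)].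
    - subst_derive (dg1 s); subst_derive (dg2 s); ring. }
  assert (h2 : is_derive (fun r => (g1 r - c1) ^ 2 + (g2 r - c2) ^ 2) s 0).
  { apply (is_derive_ext (fun _ => rho ^ 2)); [intros r; now rewrite hc|].
    apply (is_derive_const (V := R_NormedModule)). }
  assert (h3 := is_derive_unique _ _ _ h1); rewrite (is_derive_unique _ _ _ h2) in h3.
  assert (b1 := hom s); assert (b2 := hlam s); symmetry in h3.
  apply Rmult_integral in h3; destruct h3; lra. }
assert (hcs := sin2_cos2_pow (th t)).
set (N := (g1 t - c1) * sin (th t) - (g2 t - c2) * cos (th t)).
assert (h1 : is_derive f t (lam t - om t * N)).
{ unfold f, N; auto_derive.
  - repeat split; first [ex_derive_by (dg1 t)|ex_derive_by (dg2 t)|ex_derive_by (dth t)].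
  - subst_derive (dg1 t); subst_derive (dg2 t); subst_derive (dth t).
    replace (lam t) with (lam t * (sin (th t) ^ 2 + cos (th t) ^ 2)) at 3 by (rewrite hcs; ring). ring. }
assert (h2 : is_derive f t 0).
{ apply (is_derive_ext (fun _ => 0)); [intros r; now rewrite f0|].
  apply (is_derive_const (V := R_NormedModule)). }
assert (h3 := is_derive_unique _ _ _ h1); rewrite (is_derive_unique _ _ _ h2) in h3.
assert (hN : N ^ 2 = rho ^ 2).
{ rewrite <- (hc t); assert (hf := f0 t); unfold f in hf.
  transitivity (((g1 t - c1) ^ 2 + (g2 t - c2) ^ 2) * (sin (th t) ^ 2 + cos (th t) ^ 2)
    - ((g1 t - c1) * cos (th t) + (g2 t - c2) * sin (th t)) ^ 2); [unfold N; ring|].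
  rewrite hf, hcs; ring. }
assert (b1 := hom t); assert (b2 := hlam t).
assert (0 < N) by nra.
assert (N = rho) by nra.
subst rho; lra.
Qed.

End SupportCurve.

(** * Tables with the Gutkin property *)

(** A class of functions closed under differentiation gives derivatives of all orders without
    computing them. *)
Inductive poly_in (B : (R -> R) -> Prop) : (R -> R) -> Prop :=
| poly_base f : B f -> poly_in B f
| poly_const c : poly_in B (fun _ => c)
| poly_plus f g : poly_in B f -> poly_in B g -> poly_in B (fun t => f t + g t)
| poly_mult f g : poly_in B f -> poly_in B g -> poly_in B (fun t => f t * g t).

Lemma poly_in_derive (B : (R -> R) -> Prop) :
  (forall f, B f -> exists f', poly_in B f' /\ forall t : R, is_derive f t (f' t)) ->
  forall f, poly_in B f -> exists f', poly_in B f' /\ forall t : R, is_derive f t (f' t).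
Proof.
intros hB f hf; induction hf as [f hf|c|f g hf [f' [pf df]] hg [g' [pg dg]]|f g hf [f' [pf df]] hg [g' [pg dg]]].
- now apply hB.
- exists (fun _ => 0); split; [apply poly_const|intros t; apply (is_derive_const (V := R_NormedModule))].
- exists (fun t => f' t + g' t); split; [now apply poly_plus|intros t].
  auto_derive; [repeat split; first [ex_derive_by (df t)|ex_derive_by (dg t)]|].
  subst_derive (df t); subst_derive (dg t); ring.
- exists (fun t => f' t * g t + f t * g' t); split.
  + apply poly_plus; now apply poly_mult.
  + intros t; auto_derive; [repeat split; first [ex_derive_by (df t)|ex_derive_by (dg t)]|].
    subst_derive (df t); subst_derive (dg t); ring.
Qed.

(* The curve [(g1, g2)] with unit tangent [(c, s)] bounds [tab]; the Larmor circle
   of squared radius [l^2 * (1 + q^2)] entering at [g t] is centred at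
   [g t - l * (q * (s, - c) + (c, s))], and [gt_gutkin] is the Gutkin property. *)
Set Implicit Arguments.
Record gutkin_table (l q L : R) (g1 g2 b c s : R -> R) (tab : R -> R -> Prop) : Prop := {
  gt_L : 0 < L;
  gt_norm : forall t, c t * c t + s t * s t = 1;
  gt_b : forall t, 0 < b t;
  gt_d1 : forall t, derivable_pt_lim g1 t (b t * c t);
  gt_d2 : forall t, derivable_pt_lim g2 t (b t * s t);
  gt_smooth : exists F : (R -> R) -> Prop, F g1 /\ F g2 /\
    forall f, F f -> exists f', F f' /\ forall t, derivable_pt_lim f t (f' t);
  gt_g1L : forall t, g1 (t + L) = g1 t;
  gt_g2L : forall t, g2 (t + L) = g2 t;
  gt_inj : forall t u, Rabs (t - u) < L -> g1 t = g1 u -> g2 t = g2 u -> t = u;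
  gt_open : forall p1 p2, tab p1 p2 -> exists eps, 0 < eps /\
    forall q1 q2, Rabs (q1 - p1) < eps -> Rabs (q2 - p2) < eps -> tab q1 q2;
  gt_zero : tab 0 0;
  gt_scale : forall a p1 p2, 0 <= a <= 1 -> tab p1 p2 -> tab (a * p1) (a * p2);
  gt_bounded : exists M, forall p1 p2, tab p1 p2 -> Rabs p1 <= M /\ Rabs p2 <= M;
  gt_adherent : forall p1 p2, (forall eps, 0 < eps ->
      exists q1 q2, Rabs (q1 - p1) < eps /\ Rabs (q2 - p2) < eps /\ tab q1 q2) ->
    ~ tab p1 p2 -> exists t, p1 = g1 t /\ p2 = g2 t;
  gt_curve_adherent : forall t eps, 0 < eps ->
    exists q1 q2, Rabs (q1 - g1 t) < eps /\ Rabs (q2 - g2 t) < eps /\ tab q1 q2;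
  gt_curve_out : forall t, ~ tab (g1 t) (g2 t);
  gt_inward : forall t h, 0 < h < 1 / 2 -> tab (g1 t - h * s t) (g2 t + h * c t);
  gt_not_circle : forall c1 c2 rho, 0 < rho ->
    ~ (forall t, (g1 t - c1) ^ 2 + (g2 t - c2) ^ 2 = rho ^ 2);
  gt_gutkin : forall t u,
    let a1 := g1 t - l * (q * s t + c t) in
    let a2 := g2 t + l * (q * c t - s t) in
    (g1 u - a1) ^ 2 + (g2 u - a2) ^ 2 = l ^ 2 * (1 + q ^ 2) ->
    (g1 u - a1) * s u - (g2 u - a2) * c u = l * q
}.
Unset Implicit Arguments.

Section GutkinTable.
Variables (l L tau k q : R) (m1 m2 th cb sb : R -> R).
Hypothesis htr : ambiguous_track l L tau k m1 m2 th cb sb.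
Hypothesis hq : - (1 / 4) <= l * q <= 1 / 4.

(** Parallel curve of [m] at signed distance [l * q = cos delta / beta] along the outward normal; it
    keeps the tangent angle [th]. *)
Definition bdry1 t := m1 t + l * q * sin (th t).
Definition bdry2 t := m2 t - l * q * cos (th t).
Definition bspeed t := cb t + q * sb t.
Definition bturn t := sb t / l.
Definition rear1 t := m1 t - l * cos (th t).
Definition rear2 t := m2 t - l * sin (th t).

Lemma l_pos : 0 < l.
Proof. apply (tr_l htr). Qed.

Lemma bdry1_derive (t : R) : is_derive bdry1 t (bspeed t * cos (th t)).
Proof.
assert (hl := l_pos); assert (d1 := tr_dm1 htr t).
assert (d2 := tr_dth htr t).
unfold bdry1, bspeed; auto_derive; [repeat split; first [ex_derive_by d1|ex_derive_by d2]|].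
subst_derive d1; subst_derive d2; field; lra.
Qed.

Lemma bdry2_derive (t : R) : is_derive bdry2 t (bspeed t * sin (th t)).
Proof.
assert (hl := l_pos); assert (d1 := tr_dm2 htr t).
assert (d2 := tr_dth htr t).
unfold bdry2, bspeed; auto_derive; [repeat split; first [ex_derive_by d1|ex_derive_by d2]|].
subst_derive d1; subst_derive d2; field; lra.
Qed.

Lemma bdry1L t : bdry1 (t + L) = bdry1 t.
Proof.
unfold bdry1; rewrite (tr_m1L htr), (tr_thL htr).
rewrite sin_plus, sin_2PI, cos_2PI; ring.
Qed.

Lemma bdry2L t : bdry2 (t + L) = bdry2 t.
Proof.
unfold bdry2; rewrite (tr_m2L htr), (tr_thL htr).
rewrite cos_plus, sin_2PI, cos_2PI; ring.
Qed.

Lemma bspeed_bturn t : bturn t / 2 <= bspeed t.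
Proof.
assert (h1 := tr_sb htr t); assert (h2 := tr_cb htr t).
assert (hl := l_pos); unfold bspeed, bturn.
replace (q * sb t) with (l * q * (sb t / l)) by (field; lra).
assert (- (1 / 4) * (17 / 16) <= l * q * (sb t / l)) by nra.
lra.
Qed.

Lemma bsupportE t : support bdry1 bdry2 th t = m1 t * sin (th t) - m2 t * cos (th t) + l * q.
Proof.
assert (h := sin2_cos2_pow (th t)); unfold support, bdry1, bdry2.
replace (l * q) with (l * q * (sin (th t) ^ 2 + cos (th t) ^ 2)) at 3 by (rewrite h; ring).
ring.
Qed.

Lemma bsupport_bound t : 1 / 2 <= support bdry1 bdry2 th t.
Proof. rewrite bsupportE; assert (h := tr_cross htr t); lra. Qed.

Lemma btangential t : Rabs (bdry1 t * cos (th t) + bdry2 t * sin (th t)) <= 1 / 10.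
Proof.
replace (bdry1 t * cos (th t) + bdry2 t * sin (th t)) with (m1 t * cos (th t) + m2 t * sin (th t))
  by (unfold bdry1, bdry2; ring).
apply (tr_dot htr).
Qed.

(** Passing to the parallel curve adds [q * sb] to both terms, so the bound does not depend on
    [q]. *)
Lemma bcurvature t : Rabs (bspeed t - bturn t * support bdry1 bdry2 th t) <= 1 / 10.
Proof.
assert (hl := l_pos).
replace (bspeed t - bturn t * support bdry1 bdry2 th t) with
  (cb t - sb t / l * (m1 t * sin (th t) - m2 t * cos (th t)))
  by (rewrite bsupportE; unfold bspeed, bturn; field; lra).
apply (tr_curv htr).
Qed.

(* [rear s] is the centre of the Larmor circle entering at [bdry s]; by the
   swap property it is also the front point [m + l * e] at [s - tau], hence the
   centre of a circle leaving at [bdry (s - tau)] with the same angle. *)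
Lemma larmor_circle_hits s u :
  (bdry1 u - rear1 s) ^ 2 + (bdry2 u - rear2 s) ^ 2 = l ^ 2 * (1 + q ^ 2) ->
  (bdry1 u - rear1 s) * sin (th u) - (bdry2 u - rear2 s) * cos (th u) = l * q.
Proof.
intros hu; assert (hl := l_pos).
assert (hcs : forall t, sin (th t) ^ 2 + cos (th t) ^ 2 = 1) by (intros t; apply sin2_cos2_pow).
assert (hf1 : rear1 s = m1 (s - tau) + l * cos (th (s - tau))).
{ rewrite (tr_swap1 htr); unfold rear1; replace (s - tau + tau) with s by ring; reflexivity. }
assert (hf2 : rear2 s = m2 (s - tau) + l * sin (th (s - tau))).
{ rewrite (tr_swap2 htr); unfold rear2; replace (s - tau + tau) with s by ring; reflexivity. }
assert (hs : dist2 bdry1 bdry2 (rear1 s) (rear2 s) s = l ^ 2 * (1 + q ^ 2)).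
{ unfold dist2, bdry1, bdry2, rear1, rear2.
  transitivity (l ^ 2 * (1 + q ^ 2) * (sin (th s) ^ 2 + cos (th s) ^ 2)); [ring|rewrite hcs; ring]. }
assert (hs' : dist2 bdry1 bdry2 (rear1 s) (rear2 s) (s - tau) = l ^ 2 * (1 + q ^ 2)).
{ unfold dist2, bdry1, bdry2; rewrite hf1, hf2.
  transitivity (l ^ 2 * (1 + q ^ 2) * (sin (th (s - tau)) ^ 2 + cos (th (s - tau)) ^ 2)); [ring|rewrite hcs; ring]. }
assert (per : forall (j : Z) t, m1 (t + IZR j * L) = m1 t /\ m2 (t + IZR j * L) = m2 t /\
  cos (th (t + IZR j * L)) = cos (th t) /\ sin (th (t + IZR j * L)) = sin (th t)).
{ intros j t; split; [|split; [|split]].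
  - apply period_Z, (tr_m1L htr).
  - apply period_Z, (tr_m2L htr).
  - apply (period_Z (fun t => cos (th t))); intros r; rewrite (tr_thL htr).
    rewrite cos_plus, sin_2PI, cos_2PI; ring.
  - apply (period_Z (fun t => sin (th t))); intros r; rewrite (tr_thL htr).
    rewrite sin_plus, sin_2PI, cos_2PI; ring. }
destruct (dist2_level bdry1 bdry2 th bspeed bturn L (tr_L htr)
  bdry1_derive bdry2_derive (tr_dth htr) (tr_sb htr)
  bspeed_bturn bdry1L bdry2L (tr_thL htr) (rear1 s) (rear2 s)
  (tr_rear htr s) btangential bcurvature s (s - tau) u) as [[j hj]|[[j hj]|[j hj]]].
- congruence.
- unfold dist2 in hs |- *; congruence.
(* If [s - tau] and [s] agreed modulo [L], the rear and front ends of one chord would coincide. *)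
- exfalso; destruct (per j s) as [e1 [e2 [e3 e4]]]; rewrite hj, e1, e3 in hf1; rewrite hj, e2, e4 in hf2.
  unfold rear1 in hf1; unfold rear2 in hf2.
  assert (h1 : cos (th s) = 0) by (apply Rmult_eq_reg_l with l; lra).
  assert (h2 : sin (th s) = 0) by (apply Rmult_eq_reg_l with l; lra).
  specialize (hcs s); rewrite h1, h2 in hcs; lra.
- destruct (per j s) as [e1 [e2 [e3 e4]]]; unfold bdry1, bdry2, rear1, rear2; rewrite hj, e1, e2, e3, e4.
  transitivity (l * q * (sin (th s) ^ 2 + cos (th s) ^ 2)); [ring|rewrite hcs; ring].
- destruct (per j (s - tau)) as [e1 [e2 [e3 e4]]]; unfold bdry1, bdry2; rewrite hf1, hf2, hj, e1, e2, e3, e4.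
  transitivity (l * q * (sin (th (s - tau)) ^ 2 + cos (th (s - tau)) ^ 2)); [ring|rewrite hcs; ring].
Qed.

(** On a circle [bspeed = rho * bturn] makes [cb] a fixed multiple of [sb]; with
    [sb ^ 2 + cb ^ 2 = 1] this forces [sb] to be constant. *)
Lemma bdry_not_circle c1 c2 rho : 0 < rho ->
  ~ (forall t, (bdry1 t - c1) ^ 2 + (bdry2 t - c2) ^ 2 = rho ^ 2).
Proof.
intros hr hc; assert (hl := l_pos).
assert (h := circle_curvature bdry1 bdry2 th bspeed bturn
  bdry1_derive bdry2_derive (tr_dth htr) (tr_sb htr)
  bspeed_bturn c1 c2 rho hr hc).
apply (tr_nonconst htr).
assert (hsb : forall t, sb t ^ 2 * (1 + (rho / l - q) ^ 2) = 1 /\ 0 < sb t).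
{ intros t; assert (hn := tr_norm htr t); specialize (h t); unfold bspeed, bturn in h.
  assert (e : cb t = (rho / l - q) * sb t).
  { replace ((rho / l - q) * sb t) with (rho * (sb t / l) - q * sb t) by (field; lra); lra. }
  rewrite e in hn; split; [rewrite <- hn at 2; ring|].
  assert (hb := tr_sb htr t).
  replace (sb t) with (l * (sb t / l)) by (field; lra); apply Rmult_lt_0_compat; lra. }
intros t t'; destruct (hsb t) as [a1 a2]; destruct (hsb t') as [b1 b2].
assert (hk := pow2_ge_0 (rho / l - q)).
apply Rsqr_inj; try lra; unfold Rsqr.
apply Rmult_eq_reg_r with (1 + (rho / l - q) ^ 2); lra.
Qed.

Definition track_gens (f : R -> R) : Prop :=
  f = m1 \/ f = m2 \/ f = cb \/ f = sb \/ f = (fun t => cos (th t)) \/ f = (fun t => sin (th t)).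

Lemma track_gens_derive f : track_gens f ->
  exists f', poly_in track_gens f' /\ forall t : R, is_derive f t (f' t).
Proof.
assert (hl := l_pos).
assert (i1 : poly_in track_gens m1) by (apply poly_base; now left).
assert (i2 : poly_in track_gens m2) by (apply poly_base; right; now left).
assert (i3 : poly_in track_gens cb) by (apply poly_base; right; right; now left).
assert (i4 : poly_in track_gens sb) by (apply poly_base; right; right; right; now left).
assert (i5 : poly_in track_gens (fun t => cos (th t))) by (apply poly_base; do 4 right; now left).
assert (i6 : poly_in track_gens (fun t => sin (th t))) by (apply poly_base; now do 5 right).
intros [-> | [-> | [-> | [-> | [-> | ->]]]]].
- exists (fun t => cb t * cos (th t)); split; [now apply poly_mult|apply (tr_dm1 htr)].
- exists (fun t => cb t * sin (th t)); split; [now apply poly_mult|apply (tr_dm2 htr)].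
- exists (fun t => - 1 * sb t * (k * (m1 t * cos (th t) + m2 t * sin (th t)))); split.
  + repeat first [assumption | apply poly_mult | apply poly_plus | apply poly_const].
  + intros t; replace (- 1 * sb t) with (- sb t) by ring; apply (tr_dcb htr).
- exists (fun t => cb t * (k * (m1 t * cos (th t) + m2 t * sin (th t)))); split.
  + repeat first [assumption | apply poly_mult | apply poly_plus | apply poly_const].
  + apply (tr_dsb htr).
- exists (fun t => - / l * (sb t * sin (th t))); split.
  + repeat first [assumption | apply poly_mult | apply poly_const].
  + intros t; assert (d := tr_dth htr t); auto_derive; [ex_derive_by d|].
    subst_derive d; field; lra.
- exists (fun t => / l * (sb t * cos (th t))); split.
  + repeat first [assumption | apply poly_mult | apply poly_const].
  + intros t; assert (d := tr_dth htr t); auto_derive; [ex_derive_by d|].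
    subst_derive d; field; lra.
Qed.

Lemma bdry_poly : poly_in track_gens bdry1 /\ poly_in track_gens bdry2.
Proof.
split.
- apply poly_plus; [|apply poly_mult; [apply poly_const|]]; apply poly_base; unfold track_gens; auto 10.
- replace bdry2 with (fun t => m2 t + - (l * q) * cos (th t))
    by (apply functional_extensionality; intros t; unfold bdry2; ring).
  apply poly_plus; [|apply poly_mult; [apply poly_const|]]; apply poly_base; unfold track_gens; auto 10.
Qed.

Lemma gutkin_table_of_track : gutkin_table l q L bdry1 bdry2 bspeed
  (fun t => cos (th t)) (fun t => sin (th t)) (table bdry1 bdry2 th).
Proof.
assert (hL := tr_L htr); assert (dt := tr_dth htr); assert (hb := tr_sb htr).
assert (tL := tr_thL htr).
change (forall t : R, is_derive th t (bturn t)) in dt.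
change (forall t, 15 / 16 <= bturn t <= 17 / 16) in hb.
constructor; trivial.
- intros t; assert (h := sin2_cos2 (th t)); unfold Rsqr in h; lra.
- intros t; assert (h1 := hb t); assert (h2 := bspeed_bturn t); lra.
- intros t; apply is_derive_Reals, bdry1_derive.
- intros t; apply is_derive_Reals, bdry2_derive.
- exists (poly_in track_gens); destruct bdry_poly as [i1 i2]; repeat split; trivial.
  intros f hf; destruct (poly_in_derive _ track_gens_derive f hf) as [f' [pf df]].
  exists f'; split; trivial; intros t; apply is_derive_Reals, df.
- exact bdry1L.
- exact bdry2L.
- exact (curve_inj bdry1 bdry2 th bspeed bturn L hL bdry1_derive bdry2_derive dt hb
    bspeed_bturn bdry1L bdry2L tL).
- exact (table_open bdry1 bdry2 th bspeed bturn L hL bdry1_derive bdry2_derive dt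
    bdry1L bdry2L tL).
- intros t; assert (h := bsupport_bound t); lra.
- intros a p1 p2 ha hp; destruct (Req_dec a 1) as [->|h1]; [now rewrite !Rmult_1_l|].
  apply (table_scale _ _ _ bsupport_bound); [lra|intros t; left; apply hp].
- exact (table_bounded bdry1 bdry2 th bturn L hL dt bdry1L bdry2L tL bsupport_bound).
- exact (adherent_boundary bdry1 bdry2 th bspeed bturn bdry1_derive bdry2_derive dt hb).
- exact (curve_adherent bdry1 bdry2 th bspeed bturn L hL bdry1_derive bdry2_derive dt hb
    bspeed_bturn bdry1L bdry2L tL bsupport_bound).
- exact (curve_not_table bdry1 bdry2 th).
- exact (table_inward bdry1 bdry2 th bspeed bturn L hL bdry1_derive bdry2_derive dt hb
    bspeed_bturn bdry1L bdry2L tL).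
- exact bdry_not_circle.
- intros t u a1 a2.
  replace a1 with (rear1 t) by (unfold a1, rear1, bdry1; ring).
  replace a2 with (rear2 t) by (unfold a2, rear2, bdry2; ring).
  apply larmor_circle_hits.
Qed.

End GutkinTable.

Lemma exists_gutkin_table (q : R) :
  exists l L g1 g2 b c s tab, 0 < l /\ gutkin_table l q L g1 g2 b c s tab.
Proof.
assert (hq := Rabs_pos q).
(* This bound on [l] gives [|l * q| <= 1 / 4], small enough for the parallel curve to stay regular
   and convex around the origin. *)
destruct (exists_ambiguous_track (/ (4 * (1 + Rabs q)))) as
  [l [L [tau [k [m1 [m2 [th [cb [sb [hl htr]]]]]]]]]]; [apply Rinv_0_lt_compat; lra|].
assert (hl0 := tr_l htr).
assert (hlq : Rabs (l * q) <= 1 / 4).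
{ rewrite Rabs_mult, (Rabs_pos_eq l) by lra.
  apply Rle_trans with (/ (4 * (1 + Rabs q)) * (1 + Rabs q)); [apply Rmult_le_compat; lra|].
  right; field; lra. }
apply Rabs_le_between in hlq.
do 8 eexists; split; [apply hl0|exact (gutkin_table_of_track l L tau k q m1 m2 th cb sb htr hlq)].
Qed.

End BicycleTracks.

(* Transfer to the notions of the statement *)
Require Import Defs.
From mathcomp Require Import all_boot all_order all_algebra.
From mathcomp Require Import all_classical all_reals all_analysis.
From mathcomp Require Import Rstruct Rstruct_topology.
From mathcomp Require Import ring lra.
Import Order.TTheory GRing.Theory Num.Theory.
Import numFieldNormedType.Exports.
Local Open Scope ring_scope.
Local Open Scope classical_set_scope.

Local Notation R := Rdefinitions.R.
Local Notation RR := (Rdefinitions.R : realType).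

Lemma derivable_of_pt_lim (f : RR -> RR) (t l : RR) :
  Ranalysis1.derivable_pt_lim f t l -> derivable f t 1 /\ f^`() t = l.
Proof.
move=> hf.
have hl : (fun h => h^-1 *: ((f \o shift t) h - f t)) @ 0^' --> l.
  apply/cvgrPdist_lt => e /RltP e0.
  have [d hd] := hf e e0.
  have d0 : 0 < (RIneq.pos d : RR) by apply/RltP; apply: RIneq.cond_pos.
  near=> h.
  have h0 : h <> 0 by apply/eqP; near: h; exact: nbhs_dnbhs_neq.
  have hh : `|h| < (RIneq.pos d : RR) by near: h; apply: dnbhs0_lt; exact: d0.
  have := hd h h0; rewrite RabsE => hd'.
  have /hd' : Rdefinitions.Rlt `|h| (RIneq.pos d) by apply/RltP.
  rewrite RabsE => /RltP; rewrite distrC /= !RealsE.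
  by rewrite [t + h]addrC /GRing.scale /= [(_ - _) / h]mulrC.
(* [derivable] is a directional derivative, so its increment is [h *: 1]. *)
have hl' : (fun h : RR => h^-1 *: ((f \o shift t) (h *: (1 : RR^o)) - f t)) @ 0^' --> l.
  have -> : (fun h : RR => h^-1 *: ((f \o shift t) (h *: (1 : RR^o)) - f t)) =
    (fun h : RR => h^-1 *: ((f \o shift t) h - f t)); last exact: hl.
  by apply/funext => h; rewrite /GRing.scale /= mulr1.
split.
  by apply/cvg_ex; exists l.
by rewrite /derive1; apply/cvg_lim.
Unshelve. all: by end_near.
Qed.

Lemma smooth_of_closed (F : (RR -> RR) -> Prop) (f : RR -> RR) :
  (forall f, F f -> exists f', F f' /\ forall t, Ranalysis1.derivable_pt_lim f t (f' t)) ->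
  F f -> smooth_fun f.
Proof.
move=> hF Ff.
have hn n : F (f^`(n)).
  elim: n => [|n /hF [f' [Ff' df]]]; first by rewrite derive1n0.
  rewrite derive1nS; suff -> : f^`(n)^`() = f' by [].
  by apply/funext => t; have [] := derivable_of_pt_lim _ _ _ (df t).
move=> n t; have [f' [_ df]] := hF _ (hn n).
by have [] := derivable_of_pt_lim _ _ _ (df t).
Qed.

Lemma utangent_eq (g : RR -> RR * RR) (t b c s : RR) :
  0 < b -> c * c + s * s = 1 -> vel g t = (b * c, b * s) -> utangent g t = (c, s).
Proof.
move=> b0 cs hv; rewrite /utangent hv /pscale /pnorm /dot /=.
have -> : b * c * (b * c) + b * s * (b * s) = b ^+ 2.
  by rewrite -[RHS]mulr1 -cs; ring.
by rewrite sqrtr_sqr gtr0_norm // !mulrA mulVf ?lt0r_neq0 // !mul1r.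
Qed.

Lemma star_shaped_connected (Om : set (RR * RR)) : Om (0, 0) ->
  (forall (a : RR) p, 0 <= a <= 1 -> Om p -> Om (a * p.1, a * p.2)) -> connected Om.
Proof.
move=> O0 Oa.
pose seg (p : RR * RR) := (fun a : RR => (a * p.1, a * p.2)) @` `[0, 1].
have -> : Om = \bigcup_(p in Om) seg p.
  apply/seteqP; split => [p Op|_ [p Op [a /= a01 <-]]].
    exists p => //; exists 1; first by rewrite /= in_itv /= ler01 lexx.
    by rewrite !mul1r -surjective_pairing.
  by apply: Oa => //; move: a01; rewrite in_itv.
apply: bigcup_connected.
  exists (0, 0) => p _; exists 0; first by rewrite /= in_itv /= lexx ler01.
  by rewrite !mul0r.
move=> p _; apply: connected_continuous_connected; first exact: segment_connected.
apply: continuous_subspaceT => a.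
apply: (@cvg_pair _ _ _ _ (nbhs (a * p.1)) (nbhs (a * p.2))); (apply: cvgM; [exact: cvg_id|exact: cvg_cst]).
Qed.

Lemma nbhs_square (p : RR * RR) (A : set (RR * RR)) :
  nbhs p A <-> exists eps : RR, 0 < eps /\
    forall q : RR * RR, `|q.1 - p.1| < eps -> `|q.2 - p.2| < eps -> A q.
Proof.
split.
  move=> /nbhs_ballP [e /= e0 he]; exists e; split => // q h1 h2.
  by apply: he; split; rewrite /ball /= distrC.
move=> [e [e0 he]]; apply/nbhs_ballP; exists e => //= q [].
by rewrite /ball /= => h1 h2; apply: he; rewrite distrC.
Qed.

Lemma not_is_circle (g : RR -> RR * RR) :
  (forall c1 c2 rho : RR, 0 < rho ->
    ~ (forall t, ((g t).1 - c1) ^+ 2 + ((g t).2 - c2) ^+ 2 = rho ^+ 2)) -> ~ is_circle g.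
Proof.
move=> hg [[c1 c2] [rho [rho0 E]]]; apply: (hg c1 c2 rho) => // t.
have : range g (g t) by exists t.
rewrite E /pnorm /dot /= !mulN1r -!expr2 => h.
by rewrite -[in RHS]h sqr_sqrtr // addr_ge0 // sqr_ge0.
Qed.

(** On a Larmor circle the velocity is [beta] times the displacement from the centre turned by a
    right angle. So the tangential part of the exit velocity is [beta] times the normal part [l * q]
    of that displacement, which is [cos delta]. *)
Lemma gutkin_of_centre (Om : set (RR * RR)) (g : RR -> RR * RR) (b c s : RR -> RR)
    (beta delta q : RR) : 0 < beta -> q * sin delta = cos delta ->
  (forall t, utangent g t = (c t, s t)) -> (forall t, c t * c t + s t * s t = 1) ->
  (forall t u, let l := beta^-1 * sin delta in
    let a1 := (g t).1 - l * (q * s t + c t) in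
    let a2 := (g t).2 + l * (q * c t - s t) in
    ((g u).1 - a1) ^+ 2 + ((g u).2 - a2) ^+ 2 = l ^+ 2 * (1 + q ^+ 2) ->
    ((g u).1 - a1) * s u - ((g u).2 - a2) * c u = l * q) ->
  gutkin Om g beta delta.
Proof.
move=> b0 hq ut cs hg t t1 u x _ _ _ gu.
have bn0 : beta != 0 by rewrite lt0r_neq0.
set l := beta^-1 * sin delta.
have := hg t u; rewrite gu /x /larmor /entry_dir !ut /padd /pscale /rot90 /dot /larmor_vel /=.
have hd := cos2Dsin2 delta; have hbt := cos2Dsin2 (beta * t1).
have hc := cs t.
rewrite -hq in hd *.
rewrite /l; move: (cos (beta * t1)) (sin (beta * t1)) (sin delta) hd hbt => C S sd hd hbt.
set v1 := q * sd * c t + sd * - s t; set v2 := q * sd * s t + sd * c t.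
set X1 := (X in X ^+ 2 + _ = _); set X2 := (X in _ + X ^+ 2 = _).
rewrite -/X1 -/X2.
(* [(X1, X2)] is the displacement from the centre: the exit velocity turned clockwise by a right
   angle and divided by [beta]. *)
have e1 : X1 = beta^-1 * (S * v1 + C * v2) by rewrite /X1 /v1 /v2; ring.
have e2 : X2 = beta^-1 * (S * v2 - C * v1) by rewrite /X2 /v1 /v2; ring.
have -> : X1 ^+ 2 + X2 ^+ 2 = (beta^-1 * sd) ^+ 2 * (1 + q ^+ 2).
  rewrite e1 e2; transitivity (beta^-1 ^+ 2 * (C ^+ 2 + S ^+ 2) * (v1 ^+ 2 + v2 ^+ 2)); first by ring.
  rewrite hbt mulr1; transitivity (beta^-1 ^+ 2 * (sd ^+ 2 * (1 + q ^+ 2) * (c t * c t + s t * s t))).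
    by rewrite /v1 /v2; ring.
  by rewrite hc; ring.
move=> /(_ erefl) h.
have -> : q * sd = beta * (beta^-1 * sd * q) by rewrite -mulrA mulVKf // mulrC.
rewrite -h e1 e2.
transitivity (beta * beta^-1 * ((S * v1 + C * v2) * s u - (S * v2 - C * v1) * c u)); last by ring.
by rewrite divff // mul1r; ring.
Qed.

Theorem theorem1p4 :
  forall delta : Rdefinitions.R, 0 < delta < pi ->
  exists (Om : set (Rdefinitions.R * Rdefinitions.R))
         (g : Rdefinitions.R -> Rdefinitions.R * Rdefinitions.R)
         (L beta : Rdefinitions.R),
    smooth_simple_closed_curve g L /\
    bounded_domain_with_boundary Om g /\
    positively_oriented Om g /\
    ~ is_circle g /\
    0 < beta /\
    gutkin Om g beta delta.
Proof.
move=> delta /andP[d0 dpi].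
have sd0 : 0 < sin delta by apply: sin_gt0_pi; rewrite d0 dpi.
(* With [q = cot delta] and the later choice [beta = sin delta / l], the squared radius
   [l ^ 2 * (1 + q ^ 2)] equals [1 / beta ^ 2]. *)
have [l [L [g1 [g2 [b [c [s [tab [/RltP l0 ht]]]]]]]]] := exists_gutkin_table (cos delta / sin delta).
have L0 : 0 < L by apply/RltP; exact: gt_L ht.
pose g (t : RR) : RR * RR := (g1 t, g2 t).
pose Om : set (RR * RR) := [set p | tab p.1 p.2].
have cs t : c t * c t + s t * s t = 1 by exact: gt_norm ht t.
have d1 (t : RR) := derivable_of_pt_lim _ _ _ (gt_d1 ht t).
have d2 (t : RR) := derivable_of_pt_lim _ _ _ (gt_d2 ht t).
have b0 t : 0 < b t by apply/RltP; exact: gt_b ht t.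
have hv t : vel g t = (b t * c t, b t * s t).
  by rewrite /vel /g; congr (_, _); [have [_] := d1 t|have [_] := d2 t].
have ut t : utangent g t = (c t, s t) by exact: utangent_eq (b0 t) (cs t) (hv t).
have OmP p : closure Om p <-> forall eps : R, Rdefinitions.Rlt 0 eps ->
    exists q1 q2, [/\ Rdefinitions.Rlt (Rbasic_fun.Rabs (q1 - p.1)) eps,
      Rdefinitions.Rlt (Rbasic_fun.Rabs (q2 - p.2)) eps & tab q1 q2].
  split.
    move=> clp eps /RltP eps0.
    have [|q [Oq [/RltP h1 /RltP h2]]] := clp [set q | `|q.1 - p.1| < eps /\ `|q.2 - p.2| < eps].
      by apply/nbhs_square; exists eps; split.
    by exists q.1, q.2; split; rewrite ?RabsE.
  move=> h B /nbhs_square [e [/RltP e0 he]].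
  have [q1 [q2 [h1 h2 tq]]] := h e e0.
  by exists (q1, q2); split => //; apply: he; apply/RltP; rewrite -RabsE.
exists Om, g, L, (sin delta / l); split; [|split; [|split; [|split; [|split]]]].
- split.
  + exact: L0.
  + have [F [F1 [F2 hF]]] := gt_smooth ht.
    by split; [exact: smooth_of_closed hF F1|exact: smooth_of_closed hF F2].
  + move=> t; rewrite hv; apply/negP => /eqP [h1 h2].
    have := cs t; have := b0 t.
    have c0 : c t = 0 by apply: (mulfI (lt0r_neq0 (b0 t))); rewrite h1 mulr0.
    have s0 : s t = 0 by apply: (mulfI (lt0r_neq0 (b0 t))); rewrite h2 mulr0.
    by rewrite c0 s0 !mul0r addr0 => _ /eqP; rewrite eq_sym oner_eq0.
  + by move=> t; congr (_, _); [exact: gt_g1L ht t|exact: gt_g2L ht t].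
  + move=> t u /andP[t0 tL] /andP[u0 uL] [h1 h2].
    apply: (gt_inj ht) => //; apply/RltP; rewrite RabsE.
    by rewrite -[Rdefinitions.Rminus _ _]/(t - u) ltr_norml; apply/andP; split; lra.
- split.
  + rewrite openE => p Op; apply/nbhs_square.
    have [e [/RltP e0 he]] := gt_open ht _ _ Op.
    exists e; split => // q h1 h2; apply: he; apply/RltP; rewrite RabsE; [exact: h1|exact: h2].
  + apply: star_shaped_connected; first exact: gt_zero ht.
    move=> a p /andP[/RleP a0 /RleP a1] Op; exact: (gt_scale ht p.1 p.2 (conj a0 a1) Op).
  + have [M hM] := gt_bounded ht; exists M => p Op; have [h1 h2] := hM _ _ Op.
    by split; apply/RleP; rewrite -RabsE.
  + by exists (0, 0); exact: gt_zero ht.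
  + apply/seteqP; split => [p [/OmP clp nO]|_ [t _ <-]].
      have [|t [h1 h2]] := gt_adherent ht p.1 p.2 _ nO.
        move=> e e0; have [q1 [q2 [k1 k2 k3]]] := clp e e0; by exists q1, q2.
      by exists t => //; rewrite /g -h1 -h2 -surjective_pairing.
    split; last exact: gt_curve_out ht t.
    apply/OmP => e e0; have [q1 [q2 [k1 [k2 k3]]]] := gt_curve_adherent ht t e0.
    by exists q1, q2.
- move=> t; exists (1 / 2); split; first by lra.
  move=> h /andP[/RltP h0 h1].
  rewrite ut /Om /padd /pscale /rot90 /= mulrN.
  apply: (gt_inward ht); split; first exact: h0.
  by apply/RltP; move: h1; rewrite !RealsE /=; lra.
- apply: not_is_circle => c1 c2 rho /RltP rho0 h.
  case: (gt_not_circle ht rho0 (c1 := c1) (c2 := c2)) => t.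
  have := h t; rewrite -!RpowE; exact.
- by rewrite divr_gt0.
- apply: (gutkin_of_centre _ _ b c s _ _ (cos delta / sin delta)) => //.
  + by rewrite divr_gt0.
  + by rewrite divfK // lt0r_neq0.
  + move=> t u; rewrite invf_div divfK ?lt0r_neq0 //= -!RpowE; exact: (gt_gutkin ht t u).
Qed.
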